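(* Let $\{\boldsymbol{Z}_n\}$ be a non-singular lower Hessenberg branching process with $M_{i,i+1}>0$ for all $i\ge 0$. If $\{\boldsymbol Z_n\}$ is irreducible, then $\tilde{\boldsymbol q}=\boldsymbol 1$ if and only if $0\le x_k<1$ for all $k\ge0$.
   Context: Lower Hessenberg branching process (LHBP): a multitype Galton-Watson process with type set $\mathcal X=\mathbb N_0=\{0,1,2,\dots\}$, started from a single individual of type $\varphi_0$. Each individual lives one generation; independently of all others, an individual of type $i$ has at death $r_\ell$ children of type $\ell$ ($\ell\in\mathcal X$) with probability $p_i(\boldsymbol r)$, where $\boldsymbol r\in R_i:=\{\boldsymbol r\in\mathbb N_0^{\mathcal X}: r_\ell=0\ \forall \ell>i+1\}$. $\boldsymbol Z_n=(Z_{n,\ell})_{\ell\in\mathcal X}$ counts the individuals of each type in generation $n$. Mean progeny matrix: $M_{i,j}$ is the expected number of type-$j$ children of a type-$i$ individual. Irreducible: in the directed graph on $\mathcal X$ with an edge $i\to j$ iff $M_{i,j}>0$ there is a path between any two vertices. Non-singular: there is $i$ with $\sum_{\boldsymbol v:|\boldsymbol v|=1}p_i(\boldsymbol v)<1$, $|\boldsymbol v|=\sum_\ell v_\ell$. Partial extinction probability vector: $\tilde{\boldsymbol q}=(\tilde q_i)$, $\tilde q_i=\mathbb P(\lim_n Z_{n,\ell}=0\ \forall\ell\in\mathcal X\mid\varphi_0=i)$. The numbers $x_k$ and $\mu_k$ are computed recursively by $x_0=M_{0,0}$ and, for $k\ge0$, $$\mu_k=\frac{M_{k,k+1}}{1-x_k},\qquad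 x_k=\sum_{i=0}^kM_{k,i}\,m_{i\to k-1},\qquad m_{i\to k-1}=\prod_{j=i}^{k-1}\mu_j,$$ with the empty product $m_{k\to k-1}=1$. The condition ''$0\le x_k<1$ for all $k$'' is to be read step by step along this recursion (it fails as soon as some $x_k$ is not in $[0,1)$). *)

(* Defs.v *)
From HB Require Import structures.
From mathcomp Require Import all_boot all_order all_algebra.
From mathcomp Require Import all_classical all_reals all_analysis.

Set Implicit Arguments.
Unset Strict Implicit.
Unset Printing Implicit Defensive.

Import Order.TTheory GRing.Theory Num.Theory.
Import numFieldNormedType.Exports.

Local Open Scope classical_set_scope.
Local Open Scope ring_scope.
Local Open Scope ereal_scope.

(* Progeny vectors allowed for a type-i individual in a lower Hessenberg
   process: no child of type larger than i + 1. *)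
Definition progeny (i : nat) : set (nat -> nat) :=
  [set r | forall l, (i.+1 < l)%N -> r l = 0%N].

(* |r|; the sum over all types is finite because r is in progeny i. *)
Definition progeny_size (i : nat) (r : nat -> nat) : nat :=
  (\sum_(l < i.+2) r l)%N.

Section offspring_law.
Context (R : realType).

(* p i r is the probability that a type-i individual has progeny r;
   only its values for r in progeny i are ever used. *)
Implicit Type p : nat -> (nat -> nat) -> R.

Definition offspring_law p : Prop :=
  forall i, (forall r, progeny i r -> (0 <= p i r)%R) /\
            \esum_(r in progeny i) (p i r)%:E = 1.

(* Expectations are valued in [0, +oo]: infinite means are not excluded. *)
Definition mean_progeny p (i j : nat) : \bar R :=
  \esum_(r in progeny i) (p i r * (r j)%:R)%:E.

Definition irreducible p : Prop :=
  forall i j, exists s : seq nat,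
    path (fun a b => 0 < mean_progeny p a b) i s /\ last i s = j.

Definition non_singular p : Prop :=
  exists i, \esum_(r in progeny i `&` [set r | progeny_size i r = 1%N])
              (p i r)%:E < 1.

(* The numbers x_k and mu_k for a nonnegative matrix M.  mu_seq M k is the list
   [:: mu_0; ...; mu_(k-1)].  They are total functions of k: as soon as some
   x_k is not in [0, 1), the values of larger index are meaningless, which does
   not affect the truth of "0 <= x_k < 1 for all k".  As usual 0 * +oo = 0. *)
Definition x_step (M : nat -> nat -> \bar R) (mu : seq (\bar R)) (k : nat) :
    \bar R :=
  \sum_(i < k.+1) M k i * \prod_(i <= j < k) nth 0 mu j.

Fixpoint mu_seq (M : nat -> nat -> \bar R) (k : nat) : seq (\bar R) :=
  if k is k'.+1 then
    let mu := mu_seq M k' in rcons mu (M k' k'.+1 / (1 - x_step M mu k'))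
  else [::].

Definition x_ (M : nat -> nat -> \bar R) (k : nat) : \bar R :=
  x_step M (mu_seq M k) k.

Definition mu_ (M : nat -> nat -> \bar R) (k : nat) : \bar R :=
  M k k.+1 / (1 - x_ M k).

Lemma nth_mu_seq M k j : (j < k)%N -> nth 0 (mu_seq M k) j = mu_ M j.
Proof.
have sz n : size (mu_seq M n) = n.
  by elim: n => //= n IH; rewrite size_rcons IH.
elim: k => // k IH; rewrite ltnS leq_eqVlt /= nth_rcons sz.
by case/predU1P => [->|jk]; [rewrite ltnn eqxx | rewrite jk IH].
Qed.

Lemma x_E M k :
  x_ M k = \sum_(i < k.+1) M k i * \prod_(i <= j < k) mu_ M j.
Proof.
apply: eq_bigr => i _; congr (_ * _).
rewrite big_nat_cond [RHS]big_nat_cond; apply: eq_bigr => j.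
by rewrite andbT => /andP[_ jk]; exact: nth_mu_seq.
Qed.

Lemma x_0 M : x_ M 0 = M 0%N 0%N.
Proof. by rewrite x_E big_ord1 big_geq// mule1. Qed.

End offspring_law.

Section process.
Context (R : realType) (d : measure_display) (T : measurableType d).
Implicit Types (P : probability T R) (p : nat -> (nat -> nat) -> R).

(* Mutual independence of a family of random variables valued in a countable
   set, every subset of the value space being an event. *)
Definition mutually_independent (I : choiceType) (E : Type) P (X : I -> T -> E) :
    Prop :=
  forall (s : seq I) (A : I -> set E), uniq s ->
    P (\bigcap_(a in [set` s]) (X a @^-1` A a)) =
    \prod_(a <- s) P (X a @^-1` A a).

(* xi n i k w is the progeny, in the outcome w, of the k-th individual of type i
   in generation n. *)
Definition offspring_family P p (xi : nat -> nat -> nat -> T -> nat -> nat) :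
    Prop :=
  [/\ (forall n i k w, progeny i (xi n i k w)),
      (forall n i k (A : set (nat -> nat)), measurable (xi n i k @^-1` A)),
      (forall n i k r, progeny i r ->
         P (xi n i k @^-1` [set r]) = (p i r)%:E) &
      mutually_independent P
        (fun a : nat * nat * nat => xi a.1.1 a.1.2 a.2)].

(* LHBP xi i0 n w l = Z_{n,l}(w) for the process started from one individual of
   type i0.  Generation n only contains types l <= i0 + n (LHBP_support), so the
   sum over parent types stops there. *)
Fixpoint LHBP (xi : nat -> nat -> nat -> T -> nat -> nat) (i0 n : nat) (w : T)
    (l : nat) : nat :=
  (if n is m.+1 then
    \sum_(i < (i0 + m).+1) \sum_(k < LHBP xi i0 m w i) xi m i k w l
  else l == i0)%N.

Lemma LHBP_support xi i0 n w l :
  (forall n i k w, progeny i (xi n i k w)) ->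
  (i0 + n < l)%N -> LHBP xi i0 n w l = 0%N.
Proof.
move=> xiP; case: n => [|n] /=; first by rewrite addn0; case: ltngtP.
move=> lt_l; rewrite big1// => i _; rewrite big1// => k _; apply: xiP.
by rewrite (leq_ltn_trans _ lt_l)// addnS ltn_ord.
Qed.

(* The vector of the probabilities of partial extinction; the convergence takes
   place in nat with its discrete topology. *)
Definition partial_extinction P xi (i : nat) : \bar R :=
  P [set w | forall l, LHBP xi i n w l @[n --> \oo] --> 0%N].

End process.

(* Main.v *)
(** Write [s^z] for [prod_l s_l^(z_l)] and [G_i(s)] for the generating function of the
progeny of a type-[i] individual, so that [E(s^(Z_(n+1)) | F_n) = G(s)^(Z_n)], where
[G(s) = (G_i(s))_i].

Suppose that [0 <= x_k < 1] for all [k].  Then [w_k = 1 / (mu_0 ... mu_(k-1))] is a positive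
solution of [M w = w], so that [W_n = sum_l Z_(n,l) w_l] is a nonnegative martingale.  By
Jensen's inequality [s = exp (- lam w)] satisfies [G(s) >= s], and a maximal inequality for
[s^(Z_n) = exp (- lam W_n)], with [lam] small, shows that [W_n] stays bounded almost surely.
Irreducibility and non-singularity provide, for each type [l], some [s >= exp (- w)] with
[G(s) >= s] and [G_l(s) > s_l]; then [E s^(Z_n)] increases by at least a multiple of
[E(s^(Z_n); Z_(n,l) > 0)] at each step, so the latter is summable in [n].  As [s^(Z_n)] is at
least [exp (- W_n)], Borel-Cantelli shows that type [l] occurs finitely often.

Conversely, let [k] be the first index with [x_k >= 1].  The vector [v] with [v_j = w_j] for
[j <= k] and [v_j = 0] for [j > k] satisfies [M v >= v], and irreducibility allows us to
enlarge it to a finitely supported [u] with [(M u)_i > u_i] on its support.  Then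
[s = 1 - eps u] satisfies [G(s) <= s] for small [eps > 0], so [E s^(Z_n) <= s_(i0)] while
[s^(Z_n) -> 1] on partial extinction, whose probability is hence at most [s_(i0) < 1].  An
infinite entry of [M] also yields such a vector [v]. *)

Require Import Defs.
From mathcomp Require Import all_boot all_order all_algebra.
From mathcomp Require Import all_classical all_reals all_analysis.
From mathcomp Require Import ring lra.

Set Implicit Arguments.
Unset Strict Implicit.
Unset Printing Implicit Defensive.

Import Order.TTheory GRing.Theory Num.Theory.
Import numFieldNormedType.Exports.

Local Open Scope classical_set_scope.
Local Open Scope ring_scope.
Local Open Scope ereal_scope.

(** * Sums over countable sets *)

Section esum_extra.
Context (R : realType).

(** The inequality [<=] follows from finite partial sums; the reverse one is the same inequality for
    the factor [c^-1] and the family [c * a]. *)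
Lemma ge0_esumZl (I : choiceType) (D : set I) (a : I -> \bar R) (c : R) :
  (0 <= c)%R -> (forall i, D i -> 0 <= a i) ->
  \esum_(i in D) (c%:E * a i) = c%:E * \esum_(i in D) a i.
Proof.
have le_esumZ (b : I -> \bar R) (k : R) : (0 <= k)%R ->
    (forall i, D i -> 0 <= b i) ->
    \esum_(i in D) (k%:E * b i) <= k%:E * \esum_(i in D) b i.
  move=> k0 b0; apply: ge_ereal_sup => /= _ [X [finX XD] <-].
  rewrite fsbig_finite//= big_seq -ge0_sume_distrr -?big_seq -?fsbig_finite//.
    by rewrite lee_wpmul2l ?lee_fin// esum_ge//; exists X.
  by move=> i; rewrite in_fset_set// inE => /XD; exact: b0.
move=> c0 a0; apply/eqP; rewrite eq_le le_esumZ//=.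
have [->|c_neq0] := eqVneq c 0%R.
  by rewrite mul0e esum_ge0// => i _; rewrite mul0e.
have {c_neq0}c0 : (0 < c)%R by rewrite lt_neqAle eq_sym c_neq0.
have ca0 i : D i -> 0 <= c%:E * a i.
  by move=> Di; rewrite mule_ge0 ?lee_fin ?(ltW c0)//; exact: a0.
rewrite -lee_pdivlMl//.
have ci0 : (0 <= c^-1)%R by rewrite invr_ge0 ltW.
apply: le_trans (le_esumZ _ _ ci0 ca0).
by apply: le_esum => i Di; rewrite muleA -EFinM mulVf ?gt_eqF// mul1e.
Qed.

Lemma esum_swap (I J : choiceType) (A : set I) (B : set J) (a : I -> J -> \bar R) :
  (forall i j, A i -> B j -> 0 <= a i j) ->
  \esum_(i in A) \esum_(j in B) a i j = \esum_(j in B) \esum_(i in A) a i j.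
Proof.
move=> a0; rewrite !esum_esum//; last by move=> j i Bj Ai; exact: a0.
rewrite (@reindex_esum R (I * J)%type (J * I)%type (A `*` B) (B `*` A)
  (fun k => (k.2, k.1)) _)//; split.
- by move=> [i j] /= [].
- by move=> [i j] [i' j'] _ _ /= [-> ->].
- by move=> [j i] /= [Bj Ai]; exists (i, j).
Qed.

Lemma esum_pt (I : choiceType) (D : set I) (h : I) (f : I -> \bar R) :
  D h -> 0 <= f h -> (forall y, D y -> y != h -> f y = 0) ->
  \esum_(y in D) f y = f h.
Proof.
move=> Dh fh0 f0; rewrite -[RHS](esum_set1 fh0) esum_mkcond [RHS]esum_mkcond.
apply: eq_esum => y _; case: ifPn => [/[!inE] Dy|].
  by have [->|yh] := eqVneq y h; [rewrite mem_set|rewrite memNset ?f0//; apply/eqP].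
by rewrite notin_setE => Dy; rewrite memNset//= => yh; apply: Dy; rewrite yh.
Qed.

End esum_extra.

Lemma measure_bigcup_esum d (T : measurableType d) (R : realType)
    (mu : {measure set T -> \bar R}) (I : choiceType) (D : set I)
    (F : I -> set T) :
  countable D -> (forall i, D i -> measurable (F i)) -> trivIset D F ->
  measurable (\bigcup_(i in D) F i) /\
  mu (\bigcup_(i in D) F i) = \esum_(i in D) mu (F i).
Proof.
elim/choicePpointed: I => I in D F *.
  by rewrite !emptyE bigcup_set0 measure0 esum_set0.
move=> /countable_bijP[B]; rewrite card_eq_sym => /card_set_bijP[f bf] mF tF.
have [fBD finj fsurj] := bf.
have mFf n : B n -> measurable (F (f n)) by move=> Bn; apply: mF; exact: fBD.
have tFf : trivIset B (F \o f).
  move=> m n Bm Bn FF; apply: finj; rewrite ?inE//.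
  by apply: tF => //; exact: fBD.
rewrite (reindex_bigcup f B)//; split; first exact: bigcup_measurable.
rewrite measure_bigcup// (@reindex_esum _ _ _ _ _ _ _ bf) nneseries_esum//.
by rewrite set_mem_set.
Qed.

(** The type [nat -> nat] is uncountable. Confining states to finitely many coordinates makes them
    countable, so that events can be split by countable additivity. *)
Definition supp_below (m : nat) : set (nat -> nat) :=
  [set z | forall l, (m <= l)%N -> z l = 0%N].

Lemma countable_supp_below m : countable (supp_below m).
Proof.
apply/countable_injP; exists (fun z => choice.pickle (mkseq z m)).
move=> y z /set_mem yP /set_mem zP /(pcan_inj choice.pickleK) e.
apply/funext => l; have [ml|lm] := leqP m l; first by rewrite yP// zP.
by have := congr1 (nth 0%N ^~ l) e; rewrite /= !nth_mkseq.
Qed.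

Lemma sub_supp_below m n : (m <= n)%N -> supp_below m `<=` supp_below n.
Proof. by move=> mn z zP l nl; apply: zP; exact: leq_trans nl. Qed.

Lemma supp_belowD m y z : supp_below m y -> supp_below m z ->
  supp_below m (fun l => y l + z l)%N.
Proof. by move=> yP zP l ml; rewrite yP// zP. Qed.

Section pw.
Context (R : realType).
Implicit Types (s : nat -> R) (z : nat -> nat).

(* [s^z], for [z] supported below [m]. *)
Definition pw m s z : R := (\prod_(l < m) s l ^+ z l)%R.

Lemma pw_widen m n s z : (m <= n)%N -> supp_below m z -> pw n s z = pw m s z.
Proof.
move=> mn zP; rewrite /pw (big_ord_widen n (fun l => s l ^+ z l)%R mn).
rewrite [RHS]big_mkcond; apply: eq_bigr => i _; case: ltnP => // mi.
by rewrite zP// expr0.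
Qed.

Lemma pwD m s y z : pw m s (fun l => y l + z l)%N = (pw m s y * pw m s z)%R.
Proof. by rewrite /pw -big_split; apply: eq_bigr => i _; rewrite exprD. Qed.

Lemma pw_ge0 m s z : (forall l, 0 <= s l)%R -> (0 <= pw m s z)%R.
Proof. by move=> s0; apply: prodr_ge0 => l _; rewrite exprn_ge0. Qed.

Lemma pw_le1 m s z : (forall l, 0 <= s l <= 1)%R -> (pw m s z <= 1)%R.
Proof.
move=> s01; apply: prodr_ile1 => l _.
have /andP[s0 s1] := s01 l.
by rewrite exprn_ge0// exprn_ile1.
Qed.

Lemma ler_pw m s s' z : (forall l, 0 <= s l)%R -> (forall l, s l <= s' l)%R ->
  (pw m s z <= pw m s' z)%R.
Proof.
move=> s0 ss'; apply: ler_prod => l _; rewrite exprn_ge0//=.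
by apply: lerXn2r; rewrite ?nnegrE// (le_trans (s0 l)).
Qed.

Lemma ltr_pw m s s' z i : (forall l, 0 < s l)%R -> (forall l, s l <= s' l)%R ->
  (i < m)%N -> (0 < z i)%N -> (s i < s' i)%R -> (pw m s z < pw m s' z)%R.
Proof.
move=> s0 ss' im zi si.
rewrite /pw (bigD1 (Ordinal im))//= [ltRHS](bigD1 (Ordinal im))//=.
set c := (X in (_ * X < _)%R); set c' := (X in (_ < _ * X)%R).
have c0 : (0 < c)%R by apply: prodr_gt0 => l _; rewrite exprn_gt0.
have cc' : (c <= c')%R.
  apply: ler_prod => l _; rewrite exprn_ge0 ?(ltW (s0 _))//=.
  by apply: lerXn2r; rewrite ?nnegrE// ltW// (lt_le_trans (s0 l)).
apply: (@lt_le_trans _ _ (s' i ^+ z i * c)%R); last first.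
  by rewrite ler_wpM2l// exprn_ge0// ltW// (lt_trans (s0 i)).
rewrite ltr_pM2r// ltrXn2r ?nnegrE -?lt0n//; first exact: ltW.
Qed.
End pw.

(** * Generating functions and independence *)

Section gf.
Context (R : realType) (p : nat -> (nat -> nat) -> R).
Hypothesis hp : offspring_law p.

(** For [s] with values in [0, 1] the sum is at most 1, so that [fine] loses nothing there. *)
Definition gf (s : nat -> R) (i : nat) : R :=
  fine (\esum_(r in progeny i) (p i r * pw i.+2 s r)%:E).

Lemma law_ge0 i r : progeny i r -> (0 <= p i r)%R.
Proof. by move=> ir; case: (hp i) => + _; exact. Qed.

Lemma gfE s i : (forall l, 0 <= s l <= 1)%R ->
  \esum_(r in progeny i) (p i r * pw i.+2 s r)%:E = (gf s i)%:E.
Proof.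
move=> s01; have [p0 p1] := hp i.
have s0 l : (0 <= s l)%R by case/andP: (s01 l).
rewrite /gf fineK// ge0_fin_numE; last first.
  by apply: esum_ge0 => r /p0 pr0; rewrite lee_fin mulr_ge0// pw_ge0.
apply: (@le_lt_trans _ _ 1); last exact: ltry.
rewrite -p1; apply: le_esum => r /p0 pr0.
by rewrite lee_fin ler_piMr// pw_le1.
Qed.

Lemma gf_ge0_le1 s i : (forall l, 0 <= s l <= 1)%R -> (0 <= gf s i <= 1)%R.
Proof.
move=> s01; have [p0 p1] := hp i.
have s0 l : (0 <= s l)%R by case/andP: (s01 l).
rewrite -!lee_fin -gfE//; apply/andP; split.
  by apply: esum_ge0 => r /p0 pr0; rewrite lee_fin mulr_ge0// pw_ge0.
rewrite -p1; apply: le_esum => r /p0 pr0.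
by rewrite lee_fin ler_piMr// pw_le1.
Qed.

End gf.

Section indep.
Context (R : realType) (d : measure_display) (T : measurableType d).
Context (P : probability T R) (p : nat -> (nat -> nat) -> R).
Context (xi : nat -> nat -> nat -> T -> nat -> nat).
Hypothesis hp : offspring_law p.
Hypothesis hxi : offspring_family P p xi.

Let idx := (nat * nat * nat)%type.
Let X (a : idx) := xi a.1.1 a.1.2 a.2.

(** Independence of [E] from all progenies with index outside [U], tested on finitely many of them
    at a time. It replaces a filtration and passes to countable disjoint unions. *)
Definition indep_off (U : set idx) (E : set T) : Prop :=
  measurable E /\
  forall (s : seq idx) (A : idx -> set (nat -> nat)), uniq s ->
    (forall a, a \in s -> ~ U a) ->
    P (E `&` \bigcap_(a in [set` s]) X a @^-1` A a) =
    P E * \prod_(a <- s) P (X a @^-1` A a).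

Let mX a A : measurable (X a @^-1` A).
Proof. by case: hxi => _ + _ _; exact. Qed.

Let mXs (s : seq idx) A : measurable (\bigcap_(a in [set` s]) X a @^-1` A a).
Proof.
rewrite bigcap_seq; elim/big_ind: _ => //; first exact: measurableI.
Qed.

Lemma indep_off_setT : indep_off set0 setT.
Proof.
split=> // s A us _; rewrite setTI probability_setT mul1e.
by case: hxi => _ _ _ /(_ s A us) ->.
Qed.

Lemma indep_off_sub (U V : set idx) E : U `<=` V -> indep_off U E -> indep_off V E.
Proof.
move=> UV [mE hE]; split=> // s A us sV; apply: hE => // a /sV nV /UV; exact: nV.
Qed.

Lemma indep_off_bigcup (I : choiceType) (D : set I) (F : I -> set T) U :
  countable D -> trivIset D F -> (forall i, D i -> indep_off U (F i)) ->
  indep_off U (\bigcup_(i in D) F i).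
Proof.
move=> cD tF hF.
have mF i : D i -> measurable (F i) by move=> /hF[].
have [mU PU] := measure_bigcup_esum P cD mF tF.
split=> // s A us sU; rewrite setI_bigcupl.
set C := \bigcap_(a in _) _.
have mFC i : D i -> measurable (F i `&` C).
  by move=> Di; apply: measurableI; [exact: mF|exact: mXs].
have tFC : trivIset D (fun i => F i `&` C).
  by move=> i j Di Dj [x [[Fi _] [Fj _]]]; apply: tF => //; exists x.
rewrite (measure_bigcup_esum P cD mFC tFC).2 PU.
set c := \prod_(a <- s) _.
have c0 : 0 <= c by apply: prode_ge0 => a _.
have /fineK cE : c \is a fin_num.
  apply: prode_fin_num => a _; exact: fin_num_measure.
rewrite muleC -cE -ge0_esumZl ?fine_ge0//.
by apply: eq_esum => i Di; rewrite cE muleC; apply: (hF i Di).2.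
Qed.

Lemma indep_off_cap U E a A : indep_off U E -> ~ U a ->
  indep_off (U `|` [set a]) (E `&` X a @^-1` A) /\
  P (E `&` X a @^-1` A) = P E * P (X a @^-1` A).
Proof.
move=> [mE hE] Ua.
have PEA : P (E `&` X a @^-1` A) = P E * P (X a @^-1` A).
  have := hE [:: a] (fun=> A) isT; rewrite big_seq1 bigcap_seq big_seq1; apply.
  by move=> b; rewrite inE => /eqP ->.
split=> //; split; first exact: measurableI.
move=> s B us sU.
have anots : a \notin s by apply/negP => /sU; apply; right.
(* The event on [X a] is absorbed into the family tested over [a :: s], so that the independence of
   [E] is applied once to the longer list. *)
pose B' b := if b == a then A else B b.
have B'E b : b \in s -> B' b = B b.
  by rewrite /B'; case: eqP => // ->; rewrite (negPf anots).
have -> : E `&` X a @^-1` A `&` \bigcap_(b in [set` s]) X b @^-1` B b =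
    E `&` \bigcap_(b in [set` a :: s]) X b @^-1` B' b.
  rewrite -setIA !bigcap_seq big_cons {1}/B' eqxx; congr (_ `&` (_ `&` _)).
  by rewrite big_seq [RHS]big_seq; apply: eq_bigr => b /B'E ->.
rewrite hE/= ?anots//; last first.
  by move=> b; rewrite inE => /orP[/eqP -> //|/sU bU Ub]; apply: bU; left.
rewrite PEA big_cons {1}/B' eqxx muleA; congr (_ * _).
by rewrite big_seq [RHS]big_seq; apply: eq_bigr => b /B'E ->.
Qed.

Definition off_sum (t : seq idx) (w : T) (l : nat) : nat :=
  (\sum_(a <- t) X a w l)%N.

(** Induction on [t], splitting [E] according to the progeny [r] of the first parent: [r] moves into
    the accumulator [h], and its index into [U]. Summing over [r] turns [p i r * s^r] into a factor
    [gf p s i]. The bound [N] lies above all types that can occur, so that [pw N] is the full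
    monomial. *)
Lemma off_sum_indep N t U E h (s : nat -> R) :
  (forall l, 0 <= s l <= 1)%R -> indep_off U E -> uniq t ->
  (forall a, a \in t -> ~ U a) ->
  (forall a, a \in t -> (a.1.2.+2 <= N)%N) -> supp_below N h ->
  (forall y, indep_off (U `|` [set` t])
     (E `&` [set w | (fun l => h l + off_sum t w l)%N = y])) /\
  \esum_(y in supp_below N)
    (pw N s y)%:E * P (E `&` [set w | (fun l => h l + off_sum t w l)%N = y]) =
  P E * (pw N s h * \prod_(a <- t) gf p s a.1.2)%:E.
Proof.
move=> s01; have s0 l : (0 <= s l)%R by case/andP: (s01 l).
elim: t => [|a t IH] in U E h * => iE.
  move=> _ _ _ hN.
  have hE y : [set w | (fun l => h l + off_sum [::] w l)%N = y] =
      if h == y then setT else set0.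
    rewrite (_ : (fun w : T => _) = fun=> h = y); last first.
      apply/funext => w; congr (_ = y); apply/funext => l.
      by rewrite /off_sum big_nil addn0.
    by case: eqVneq => [->|/eqP hy]; apply/seteqP; split.
  split.
    move=> y; rewrite hE; case: ifP => _.
      by rewrite setIT; apply: indep_off_sub iE; left.
    rewrite setI0; split=> // s' A _ _; rewrite set0I measure0 mul0e//.
  rewrite (@esum_pt _ _ _ h)//.
  - by rewrite hE eqxx setIT big_nil mulr1 muleC.
  - by rewrite mule_ge0// lee_fin pw_ge0.
  - by move=> y _ yh; rewrite hE eq_sym (negPf yh) setI0 measure0 mule0.
move=> /= /andP[anott ut] tU tN hN.
have Ua : ~ U a by apply: tU; rewrite mem_head.
have aN : (a.1.2.+2 <= N)%N by apply: tN; rewrite mem_head.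
pose F r := E `&` X a @^-1` [set r].
have iF r := indep_off_cap [set r] iE Ua.
have hrN r : progeny a.1.2 r -> supp_below N (fun l => h l + r l)%N.
  by move=> ar; apply: supp_belowD => //; exact: sub_supp_below ar.
have tU' b : b \in t -> ~ (U `|` [set a]) b.
  move=> bt [|/= ba]; first by apply: tU; rewrite inE bt orbT.
  by move: anott; rewrite -ba bt.
have tN' b : b \in t -> (b.1.2.+2 <= N)%N by move=> bt; rewrite tN// inE bt orbT.
have {}IH r (ar : progeny a.1.2 r) :=
  IH _ _ _ (iF r).1 ut tU' tN' (hrN r ar).
pose G y r := F r `&` [set w | (fun l => h l + r l + off_sum t w l)%N = y].
have EG y : E `&` [set w | (fun l => h l + off_sum (a :: t) w l)%N = y] =
    \bigcup_(r in progeny a.1.2) G y r.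
  have eX w r : X a w = r ->
      (fun l => h l + off_sum (a :: t) w l)%N = (fun l => h l + r l + off_sum t w l)%N.
    by move=> <-; apply/funext => l; rewrite /off_sum big_cons addnA.
  apply/seteqP; split=> [w [Ew /= hw]|w [r ar [[Ew Xw] /= hw]]].
    exists (X a w); first by case: hxi => + _ _ _; exact.
    by split=> //=; rewrite -(eX w _ erefl).
  by split=> //=; rewrite (eX w r).
have tG y : trivIset (progeny a.1.2) (G y).
  by move=> r r' _ _ [w [[[_ /= <-] _] [[_ /= <-] _]]].
have cprog : countable (progeny a.1.2) by exact: countable_supp_below.
have iG y r : progeny a.1.2 r -> indep_off (U `|` [set` a :: t]) (G y r).
  move=> ar; apply: indep_off_sub ((IH r ar).1 y) => b [[Ub|/= ->]|/= bt].
  - by left.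
  - by right; rewrite /= mem_head.
  - by right; rewrite /= inE bt orbT.
split=> [y|]; first by rewrite EG; apply: (indep_off_bigcup cprog (tG y)) => r ar; exact: iG.
transitivity (\esum_(y in supp_below N) \esum_(r in progeny a.1.2)
    (pw N s y)%:E * P (G y r)).
  apply: eq_esum => y _; rewrite EG (measure_bigcup_esum P cprog _ (tG y)).2.
    by rewrite ge0_esumZl ?pw_ge0.
  by move=> r /(iG y)[].
rewrite esum_swap; last by move=> *; rewrite mule_ge0// lee_fin pw_ge0.
under eq_esum => r ar do rewrite (IH r ar).2 (iF r).2.
have PE : P E \is a fin_num by apply: fin_num_measure; case: iE.
rewrite big_cons mulrCA EFinM -gfE// -[in RHS](fineK PE) [in RHS]muleCA.
transitivity (\esum_(r in progeny a.1.2)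
   ((fine (P E) * (pw N s h * \prod_(j <- t) gf p s j.1.2))%:E
     * (p a.1.2 r * pw a.1.2.+2 s r)%:E)).
  apply: eq_esum => r ar; have -> : P (X a @^-1` [set r]) = (p a.1.2 r)%:E.
    by case: hxi => _ _ /(_ _ _ _ r ar) + _; exact.
  rewrite -(fineK PE) -!EFinM; congr EFin.
  by rewrite pwD (pw_widen _ aN ar); ring.
rewrite ge0_esumZl ?mulr_ge0 ?fine_ge0 ?pw_ge0 ?prodr_ge0//.
- by rewrite EFinM muleC.
- by move=> b _; case/andP: (gf_ge0_le1 hp b.1.2 s01).
- by move=> r ar; rewrite lee_fin mulr_ge0 ?pw_ge0// (law_ge0 hp).
Qed.
End indep.

(** * The law of the process *)

Section process_law.
Context (R : realType) (d : measure_display) (T : measurableType d).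
Context (P : probability T R) (p : nat -> (nat -> nat) -> R).
Context (xi : nat -> nat -> nat -> T -> nat -> nat).
Hypothesis hp : offspring_law p.
Hypothesis hxi : offspring_family P p xi.
Variable i0 : nat.

Local Notation Z := (LHBP xi i0).
Local Notation width n := (i0 + n).+1.

Definition parents (n : nat) (z : nat -> nat) : seq (nat * nat * nat) :=
  [seq (n, i, k) | i <- iota 0 (width n), k <- iota 0 (z i)].

Lemma LHBP_supp_below n w : supp_below (width n) (Z n w).
Proof. by move=> l nl; apply: LHBP_support => //; case: hxi. Qed.

Lemma LHBPS n w : Z n.+1 w = off_sum xi (parents n (Z n w)) w.
Proof.
apply/funext => l; rewrite /off_sum /parents big_allpairs_dep.
transitivity (\sum_(0 <= i < width n) \sum_(0 <= k < Z n w i) xi n i k w l)%N.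
  by rewrite big_mkord; apply: eq_bigr => i _; rewrite big_mkord.
by rewrite /index_iota subn0; apply: eq_bigr => i _; rewrite subn0.
Qed.

Lemma uniq_parents n z : uniq (parents n z).
Proof.
apply: allpairs_uniq_dep => [|i _|]; rewrite ?iota_uniq//.
by move=> [i k] [i' k'] _ _ /= [-> ->].
Qed.

Lemma mem_parents n z a : a \in parents n z ->
  a.1.1 = n /\ (a.1.2 < width n)%N.
Proof.
by move=> /allpairsPdep[i [k [+ _ ->]]]; rewrite mem_iota add0n.
Qed.

Lemma prod_parents n z (g : nat -> R) :
  (\prod_(a <- parents n z) g a.1.2 = pw (width n) g z)%R.
Proof.
rewrite /parents big_allpairs_dep /pw.
rewrite -(big_mkord xpredT (fun i => g i ^+ z i)%R) /index_iota subn0.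
by apply: eq_bigr => i _; rewrite /= big_const_seq count_predT size_iota iter_mulr_1.
Qed.

(* Replaces measurability of [B] for the generations before [n]: only independence from the
   later progenies is ever used. *)
Definition past (n : nat) (B : set T) : Prop :=
  forall z, indep_off P xi [set a | (a.1.1 < n)%N] (B `&` [set w | Z n w = z]).

Lemma past0 : past 0 setT.
Proof.
move=> z; rewrite setTI.
have ->: [set w | Z 0 w = z] = if `[< (fun l => (l == i0) : nat) = z >] then setT else set0.
  by case: asboolP => h; apply/seteqP; split.
case: ifP => _; first by apply: indep_off_sub (indep_off_setT hxi).
by split=> // s A _ _; rewrite set0I measure0 mul0e.
Qed.

Lemma trivIset_LHBP n B D : trivIset D (fun z => B `&` [set w | Z n w = z]).
Proof. by move=> y z _ _ [w [[_ /= <-] [_ /= <-]]]. Qed.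

Lemma LHBP_bigcup n B D : B `&` [set w | D (Z n w)] =
  \bigcup_(z in supp_below (width n) `&` D) (B `&` [set w | Z n w = z]).
Proof.
apply/seteqP; split=> [w [Bw Dw]|w [z [_ Dz] [Bw /= zE]]].
  by exists (Z n w) => //; split=> //; exact: LHBP_supp_below.
by split=> //=; rewrite zE.
Qed.

Let countable_states n D : countable (supp_below (width n) `&` D).
Proof.
apply: sub_countable (countable_supp_below (width n)).
by apply: subset_card_le => z [].
Qed.

Let hwidth n z a : a \in parents n z -> (a.1.2.+2 <= width n.+1)%N.
Proof. by move=> /mem_parents[_]; rewrite addnS !ltnS. Qed.

Let hpast n z a : a \in parents n z -> ~ [set a | (a.1.1 < n)%N] a.
Proof. by move=> /mem_parents[an _]; rewrite /mkset an ltnn. Qed.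

Let supp0 n : supp_below n (fun=> 0%N). Proof. by []. Qed.

(** On the event [Z n = z] the random set of parents is the fixed list [parents n z], to which
    [off_sum_indep] applies. *)
Let step n z y B : B `&` [set w | Z n w = z] `&` [set w | Z n.+1 w = y] =
  B `&` [set w | Z n w = z] `&`
    [set w | (fun l => 0 + off_sum xi (parents n z) w l)%N = y].
Proof.
apply/seteqP; split=> w [[Bw zE] h]; split=> //; move: h; rewrite /mkset LHBPS.
  by rewrite [Z n w]zE.
by rewrite [Z n w]zE.
Qed.

Lemma pastS n B D : past n B -> past n.+1 (B `&` [set w | D (Z n w)]).
Proof.
move=> pB y; rewrite LHBP_bigcup setI_bigcupl.
apply: (indep_off_bigcup hxi) => //.
  by move=> z z' _ _ [w [[[_ /= <-] _] [[_ /= <-] _]]].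
move=> z _; rewrite step.
(* Only the independence half of [off_sum_indep] is wanted, so any [s] with values in [0, 1] will
   do. *)
pose s (_ : nat) : R := 0%R.
have s01 l : (0 <= s l <= 1)%R by rewrite lexx ler01.
have [+ _] := off_sum_indep hp hxi s01 (pB z) (uniq_parents n z) (@hpast n z)
  (@hwidth n z) (@supp0 _).
move=> /(_ y); apply: indep_off_sub => a [/= an|/= /mem_parents[-> _]//].
exact: ltnW.
Qed.

Lemma past_measurable n B D : past n B -> measurable (B `&` [set w | D (Z n w)]).
Proof.
move=> pB; rewrite LHBP_bigcup.
by apply: (measure_bigcup_esum P _ _ (@trivIset_LHBP n B _)).1 => // z _; case: (pB z).
Qed.

(* [E(f(Z_n); B)] *)
Definition expect n (B : set T) (f : (nat -> nat) -> R) : \bar R :=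
  \esum_(z in supp_below (width n)) (f z)%:E * P (B `&` [set w | Z n w = z]).

Lemma expect_ge0 n B f : (forall z, 0 <= f z)%R -> 0 <= expect n B f.
Proof. by move=> f0; apply: esum_ge0 => z _; rewrite mule_ge0 ?lee_fin. Qed.

Lemma le_expect n B f g : (forall z, supp_below (width n) z -> f z <= g z)%R ->
  expect n B f <= expect n B g.
Proof. by move=> fg; apply: le_esum => z /fg fgz; rewrite lee_wpmul2r ?lee_fin. Qed.

Lemma expectD n B f g : (forall z, 0 <= f z)%R -> (forall z, 0 <= g z)%R ->
  expect n B (fun z => f z + g z)%R = expect n B f + expect n B g.
Proof.
move=> f0 g0; rewrite /expect -esumD; last 2 first.
- by move=> z _; rewrite mule_ge0 ?lee_fin.
- by move=> z _; rewrite mule_ge0 ?lee_fin.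
by apply: eq_esum => z _; rewrite EFinD ge0_muleDl ?lee_fin.
Qed.

Lemma expectZ n B f c : (0 <= c)%R -> (forall z, 0 <= f z)%R ->
  expect n B (fun z => c * f z)%R = c%:E * expect n B f.
Proof.
move=> c0 f0; rewrite /expect -ge0_esumZl//.
  by apply: eq_esum => z _; rewrite EFinM muleA.
by move=> z _; rewrite mule_ge0 ?lee_fin.
Qed.

Lemma prob_expect n B D : past n B ->
  P (B `&` [set w | D (Z n w)]) = expect n B (fun z => (`[< D z >])%:R).
Proof.
move=> pB; rewrite LHBP_bigcup.
rewrite (measure_bigcup_esum P (@countable_states n D) _ (@trivIset_LHBP n B _)).2; last first.
  by move=> z _; case: (pB z).
rewrite esum_mkcondr; apply: eq_esum => z _.
case: asboolP => Dz; first by rewrite mem_set// mul1e.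
by rewrite memNset// mul0e.
Qed.

Lemma expect_restrict n B D f : (forall z, 0 <= f z)%R ->
  expect n (B `&` [set w | D (Z n w)]) f = expect n B (fun z => (`[< D z >])%:R * f z)%R.
Proof.
move=> f0; apply: eq_esum => z _.
case: asboolP => Dz; rewrite (mul1r, mul0r).
  congr (_ * P _); apply/seteqP; split=> [w [[]]//|w [Bw /= zE]].
  by split=> //; split=> //=; rewrite zE.
rewrite mul0e (_ : _ `&` _ = set0) ?measure0 ?mule0//.
by rewrite -subset0 => w [[_ /= Dw] /= zE]; apply: Dz; rewrite -zE.
Qed.

Lemma expect0 s : (0 <= s i0)%R -> expect 0 setT (pw (width 0) s) = (s i0)%:E.
Proof.
move=> s0; pose h l : nat := l == i0.
have hE : pw (width 0) s h = s i0.
  rewrite /pw addn0 big_ord_recr /= big1 ?mul1r.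
    by rewrite /h eqxx expr1.
  by move=> i _; rewrite /h ltn_eqF// expr0.
have PhE : P (setT `&` [set w | Z 0 w = h]) = 1.
  by rewrite setTI (_ : [set w | _] = setT) ?probability_setT//; apply/seteqP; split.
rewrite /expect (@esum_pt _ _ _ h) ?PhE ?hE ?mule1//.
- by move=> l; rewrite addn0 /h => il; rewrite gtn_eqF.
- move=> y _ /eqP yh; rewrite setTI (_ : [set w | _] = set0) ?measure0 ?mule0//.
  by rewrite -subset0 => w /= yE; apply: yh; rewrite -yE.
Qed.

(** The branching property: given [Z n = z], the next generation is a sum of independent progenies,
    whose generating function is [G(s)^z]. Tonelli exchanges the sums over the two generations. *)
Lemma expectS n B s : past n B -> (forall l, 0 <= s l <= 1)%R ->
  expect n.+1 B (pw (width n.+1) s) = expect n B (pw (width n) (gf p s)).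
Proof.
move=> pB s01; have s0 l : (0 <= s l)%R by case/andP: (s01 l).
transitivity (\esum_(y in supp_below (width n.+1)) \esum_(z in supp_below (width n))
   ((pw (width n.+1) s y)%:E * P (B `&` [set w | Z n w = z] `&` [set w | Z n.+1 w = y]))).
  apply: eq_esum => y _; rewrite ge0_esumZl ?pw_ge0//; congr (_ * _).
  have -> : B `&` [set w | Z n.+1 w = y] = \bigcup_(z in supp_below (width n))
      (B `&` [set w | Z n w = z] `&` [set w | Z n.+1 w = y]).
    rewrite -setI_bigcupl; congr (_ `&` _).
    by rewrite -[X in \bigcup_(z in X) _]setIT -LHBP_bigcup setIT.
  apply: (measure_bigcup_esum P _ _ _).2.
  - exact: countable_supp_below.
  - move=> z _; rewrite step.
    by have [+ _] := off_sum_indep hp hxi s01 (pB z) (uniq_parents n z) (@hpast n z)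
      (@hwidth n z) (@supp0 _); move=> /(_ y)[].
  - by move=> z z' _ _ [w [[[_ /= <-] _] [[_ /= <-] _]]].
rewrite esum_swap; last by move=> *; rewrite mule_ge0// lee_fin pw_ge0.
apply: eq_esum => z _.
have [_] := off_sum_indep hp hxi s01 (pB z) (uniq_parents n z) (@hpast n z)
  (@hwidth n z) (@supp0 _).
rewrite prod_parents muleC (_ : pw _ s (fun=> 0%N) = 1%R) ?mul1r => [<-|].
  by apply: eq_esum => y _; rewrite step.
by rewrite /pw big1// => i _; rewrite expr0.
Qed.

End process_law.

(** * Visits to a type and the probability of partial extinction *)

Section extinction.
Context (R : realType) (d : measure_display) (T : measurableType d).
Context (P : probability T R) (p : nat -> (nat -> nat) -> R).
Context (xi : nat -> nat -> nat -> T -> nat -> nat).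
Hypothesis hp : offspring_law p.
Hypothesis hxi : offspring_family P p xi.
Variable i0 : nat.

Local Notation Z := (LHBP xi i0).
Local Notation width n := (i0 + n).+1.
Local Notation past := (past P xi i0).
Local Notation expect := (expect P xi i0).

(** In contrast to [pastS], the time does not advance: each slice [Z n = z] is either kept whole or
    emptied. *)
Lemma past_restrict n B (D : set (nat -> nat)) :
  past n B -> past n (B `&` [set w | D (Z n w)]).
Proof.
move=> pB z; have [Dz|nDz] := pselect (D z).
  have -> : B `&` [set w | D (Z n w)] `&` [set w | Z n w = z] = B `&` [set w | Z n w = z].
    apply/seteqP; split=> [w [[]]//|w [Bw /= zE]].
    by split=> //; split=> //=; rewrite zE.
  exact: pB.
rewrite (_ : _ `&` _ = set0).
  by split=> // s A _ _; rewrite set0I measure0 mul0e.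
by rewrite -subset0 => w [[_ /= Dw] /= zE]; apply: nDz; rewrite -zE.
Qed.

Lemma pastT n : past n setT.
Proof.
elim: n => [|n IH]; first exact: (past0 hxi).
by have := pastS hp hxi setT IH; rewrite setIT.
Qed.

Lemma LHBP_measurable n (D : set (nat -> nat)) : measurable [set w | D (Z n w)].
Proof. by rewrite -[X in measurable X]setTI; exact: (past_measurable hxi D (pastT n)). Qed.

Definition visit l n : set T := [set w | (0 < Z n w l)%N].

Lemma visit_measurable l n : measurable (visit l n).
Proof. exact: (LHBP_measurable n (fun z => (0 < z l)%N)). Qed.

Lemma lim_sup_visit_measurable l : measurable (lim_sup_set (visit l)).
Proof.
apply: bigcap_measurableType => n _.
by apply: bigcup_measurable => j _; exact: visit_measurable.
Qed.

(** In the discrete topology, convergence to 0 means being eventually 0, that is, visiting each type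
    only finitely often. *)
Lemma partial_extinction_setE :
  [set w | forall l, Z n w l @[n --> \oo] --> 0%N] =
  ~` \bigcup_l lim_sup_set (visit l).
Proof.
rewrite setC_bigcup; apply/seteqP; split=> [w hw l _ hl|w hw l].
  have [N _ hN] := hw l [set 0%N] (discrete_set1 _).
  have [n /= Nn] := hl N I.
  by rewrite /visit /= (hN n Nn).
have := hw l I.
move=> /existsNP[N /not_implyP[_ hN]] A A0.
exists N => // n Nn; rewrite /=.
suff -> : Z n w l = 0%N by exact: nbhs_singleton.
by apply/eqP; rewrite -leqn0 leqNgt; apply/negP => h; apply: hN; exists n.
Qed.

Lemma partial_extinction_eq1 :
  (forall l, P (lim_sup_set (visit l)) = 0) -> partial_extinction P xi i0 = 1.
Proof.
move=> h; rewrite /partial_extinction partial_extinction_setE.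
have mU : measurable (\bigcup_l lim_sup_set (visit l)).
  by apply: bigcup_measurable => l _; exact: lim_sup_visit_measurable.
rewrite probability_setC//.
rewrite (_ : P _ = 0) ?sube0//; apply: measure_negligible => //.
apply: negligible_bigcup => l.
by apply/negligibleP; [exact: lim_sup_visit_measurable|exact: h].
Qed.

(** As [G(s) <= s], the expectation of [s^(Z_n)] never exceeds its initial value [s i0], while
    [s^(Z_n) = 1] as soon as all types below [K] are absent. *)
Lemma partial_extinction_le K (s : nat -> R) :
  (forall l, 0 <= s l <= 1)%R -> (forall l, (K <= l)%N -> s l = 1%R) ->
  (forall l, gf p s l <= s l)%R -> partial_extinction P xi i0 <= (s i0)%:E.
Proof.
move=> s01 sK gs; have s0 l : (0 <= s l)%R by case/andP: (s01 l).
have ale n : expect n setT (pw (width n) s) <= (s i0)%:E.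
  elim: n => [|n IH]; first by rewrite expect0.
  rewrite (expectS hp hxi (pastT n) s01); apply: le_trans IH.
  apply: le_expect => z _; apply: ler_pw => // l.
  by case/andP: (gf_ge0_le1 hp l s01).
pose D : set (nat -> nat) := fun z => forall l, (l < K)%N -> z l = 0%N.
(* The events [F N] increase with [N]. Partial extinction lies in their union because finitely many
   types, those below [K], have a common last generation. *)
pose F N := \bigcap_(n in [set n | (N <= n)%N]) [set w | D (Z n w)].
have mF N : measurable (F N).
  by apply: bigcap_measurableType => n _; exact: LHBP_measurable.
have PF N : P (F N) <= (s i0)%:E.
  apply: le_trans (ale N).
  apply: (@le_trans _ _ (P [set w | D (Z N w)])).
    apply: le_measure; rewrite ?inE//; first exact: LHBP_measurable.
    by move=> w; apply => /=.
  rewrite -[X in P X]setTI (prob_expect hxi D (pastT N)).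
  apply: le_expect => z _; case: asboolP => Dz; last exact: pw_ge0.
  rewrite /pw big1// => l _; have [lK|Kl] := ltnP l K; first by rewrite Dz.
  by rewrite sK// expr1n.
have mUF : measurable (\bigcup_N F N) by exact: bigcup_measurable.
apply: (@le_trans _ _ (P (\bigcup_N F N))).
  apply: le_measure; rewrite ?inE//.
    rewrite partial_extinction_setE; apply: measurableC.
    by apply: bigcup_measurable => l _; exact: lim_sup_visit_measurable.
  move=> w /= hw.
  have : \forall n \near \oo, D (Z n w).
    have : \forall n \near \oo, forall l : 'I_K, Z n w l = 0%N.
      apply: filter_forall => l.
      by apply: (hw l [set 0%N]); exact: discrete_set1.
    by apply: filterS => n h l lK; exact: (h (Ordinal lK)).
  by move=> [N _ hN]; exists N.
have cF : P (F N) @[N --> \oo] --> P (\bigcup_N F N).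
  apply: nondecreasing_cvg_mu => // m n mn.
  apply/subsetPset => w hw k nk; apply: hw; exact: leq_trans nk.
rewrite -(cvg_lim _ cF)//; apply: lime_le; first by apply/cvg_ex; eexists; exact: cF.
exact: nearW.
Qed.

Lemma expect_visit_summable l (s : nat -> R) :
  (forall j, 0 < s j <= 1)%R -> (forall j, s j <= gf p s j)%R ->
  (s l < gf p s l)%R ->
  \sum_(n <oo) expect n setT (fun z => (0 < z l)%N%:R * pw (width n) s z)%R < +oo.
Proof.
move=> s01 gs gsl.
have s0 j : (0 < s j)%R by case/andP: (s01 j).
have s01' j : (0 <= s j <= 1)%R by case/andP: (s01 j) => /ltW -> ->.
(* Since [gf p s l = (1 + c) * s l], one has [G(s)^z >= (1 + c) s^z] whenever type [l] occurs in
   [z]. Each generation thus adds at least [c] times the summand to an expectation that stays below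
   1, and the series is at most [1 / c]. *)
pose c := (gf p s l / s l - 1)%R.
have c0 : (0 < c)%R by rewrite subr_gt0 ltr_pdivlMr// mul1r.
pose e n := expect n setT (fun z => (0 < z l)%N%:R * pw (width n) s z)%R.
rewrite -[ltLHS]/(\sum_(n <oo) e n).
have e0 n : 0 <= e n.
  by apply: expect_ge0 => z; rewrite mulr_ge0// pw_ge0// => j; exact: ltW.
have key n : c%:E * \sum_(0 <= m < n) e m <= expect n setT (pw (width n) s).
  elim: n => [|n IH].
    by rewrite big_nil mule0 expect_ge0// => z; rewrite pw_ge0// => j; exact: ltW.
  rewrite (expectS hp hxi (pastT n) s01') big_nat_recr//= muleDr//; last first.
    by apply: ge0_adde_def; rewrite inE ?sume_ge0.
  apply: le_trans (leeD IH (lexx _)) _.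
  rewrite -expectZ ?(ltW c0)//; last first.
    by move=> z; rewrite mulr_ge0// pw_ge0// => j; exact: ltW.
  rewrite -expectD; last 2 first.
  - by move=> z; rewrite pw_ge0// => j; exact: ltW.
  - by move=> z; rewrite !mulr_ge0 ?(ltW c0)// pw_ge0// => j; exact: ltW.
  apply: le_expect => z zn.
  have -> : pw (width n) (gf p s) z =
      (pw (width n) s z * pw (width n) (fun j => gf p s j / s j) z)%R.
    rewrite /pw -big_split; apply: eq_bigr => j _ /=.
    by rewrite -exprMn mulrCA divff ?mulr1// gt_eqF.
  have r1 j : (1 <= gf p s j / s j)%R by rewrite ler_pdivlMr// mul1r.
  have [zl|] := ltnP 0%N (z l); last first.
    rewrite leqn0 => /eqP zl; rewrite mul0r mulr0 addr0.
    rewrite ler_peMr ?pw_ge0// => [j|]; first exact: ltW.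
    rewrite -[leLHS](_ : pw (width n) (fun=> 1%R) z = 1%R).
      exact: ler_pw.
    by rewrite /pw big1// => j _; rewrite expr1n.
  rewrite mul1r -[X in (X + _)%R]mul1r -mulrDl mulrC.
  rewrite ler_wpM2l ?pw_ge0// => [j|]; first exact: ltW.
  rewrite /c addrC subrK.
  have ln : (l < width n)%N.
    by rewrite ltnNge; apply/negP => /zn zl0; rewrite zl0 in zl.
  rewrite /pw (bigD1 (Ordinal ln))//= -[leLHS]mulr1.
  apply: ler_pM => //; first by rewrite (le_trans ler01).
    by rewrite -{1}[leLHS]expr1 ler_weXn2l.
  apply: (big_ind (fun x => 1 <= x)%R) => // [x y x1 y1|j _].
    by rewrite mulr_ege1.
  exact: exprn_ege1.
apply: (@le_lt_trans _ _ (c^-1)%:E); last exact: ltry.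
apply: lime_le; first exact: is_cvg_nneseries.
apply: nearW => n; rewrite -[leRHS]mule1 lee_pdivlMl//.
apply: le_trans (key n) _.
apply: (@le_trans _ _ (expect n setT (fun z => (`[< setT z >])%:R))).
  by apply: le_expect => z _; rewrite asboolT// pw_le1.
rewrite -(prob_expect hxi setT (pastT n)) probability_le1//.
by apply: measurableI => //; exact: LHBP_measurable.
Qed.

End extinction.

(** * A maximal inequality and a criterion for almost sure partial extinction *)

Section maximal.
Context (R : realType) (d : measure_display) (T : measurableType d).
Context (P : probability T R) (p : nat -> (nat -> nat) -> R).
Context (xi : nat -> nat -> nat -> T -> nat -> nat).
Hypothesis hp : offspring_law p.
Hypothesis hxi : offspring_family P p xi.
Variable i0 : nat.

Local Notation Z := (LHBP xi i0).
Local Notation width n := (i0 + n).+1.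
Local Notation past := (past P xi i0).
Local Notation expect := (expect P xi i0).

(** Only generations strictly before [n] are constrained, which makes the event a [past n] one and
    leaves the step from [n] to [n + 1] free. *)
Fixpoint stays_in (D : nat -> set (nat -> nat)) (n : nat) : set T :=
  if n is m.+1 then stays_in D m `&` [set w | D m (Z m w)] else setT.

Lemma past_stays_in D n : past n (stays_in D n).
Proof. by elim: n => [|n IH] /=; [exact: (past0 hxi)|exact: pastS]. Qed.

Lemma stays_in_measurable D n : measurable (stays_in D n).
Proof.
have := past_measurable hxi setT (past_stays_in D n).
by rewrite (_ : [set w | _] = setT) ?setIT//; apply/seteqP.
Qed.

(* [E(s^(Z_n); B_n) + theta P(~ B_n)], where [B_n] is the event that [s^(Z_m) > theta] for all
   [m < n], is nondecreasing in [n]. *)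
Lemma maximal_ineq (s : nat -> R) (theta : R) n :
  (forall j, 0 <= s j <= 1)%R -> (forall j, s j <= gf p s j)%R ->
  (0 <= theta)%R ->
  (s i0)%:E + P (~` stays_in (fun m z => theta < pw (width m) s z)%R n) <=
  1 + theta%:E * P (~` stays_in (fun m z => theta < pw (width m) s z)%R n).
Proof.
move=> s01 gs th0; have s0 j : (0 <= s j)%R by case/andP: (s01 j).
set D := fun m z => _.
have pw0 m z : (0 <= pw m s z)%R by exact: pw_ge0.
have key : (s i0)%:E <=
    expect n (stays_in D n) (pw (width n) s) + theta%:E * P (~` stays_in D n).
  elim: n => [|n IH].
    by rewrite /= expect0// setCT measure0 mule0 adde0.
  apply: le_trans IH _ => /=.
  set B := stays_in D n.
  have pB : past n B := past_stays_in D n.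
  rewrite (expectS hp hxi (past_restrict (D n) pB) s01).
  have -> : P (~` (B `&` [set w | D n (Z n w)])) =
      P (~` B) + P (B `&` [set w | ~ D n (Z n w)]).
    rewrite setCI -measureU.
    - congr (P _); apply/seteqP; split=> w /=.
        by case: (pselect (B w)) => Bw; tauto.
      by tauto.
    - by apply: measurableC; exact: stays_in_measurable.
    - exact: (past_measurable hxi (fun z => ~ D n z) pB).
    - by rewrite setIA setICl set0I.
  rewrite ge0_muleDr// [_ * P (~` B) + _]addeC addeA leeD2r//.
  rewrite (prob_expect hxi (fun z => ~ D n z) pB) -expectZ//.
  (* On [D n] the state keeps its value [s^z]; off [D n] this value is at most [theta], the amount
     credited for leaving. *)
  apply: (@le_trans _ _ (expect n (B `&` [set w | D n (Z n w)]) (pw (width n) s) +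
     expect n B (fun z => theta * (`[< ~ D n z >])%:R)%R)).
    rewrite expect_restrict// -expectD; last 2 first.
    - by move=> z; rewrite mulr_ge0.
    - by move=> z; rewrite mulr_ge0.
    apply: le_expect => z _; case: (pselect (D n z)) => Dz.
      by rewrite asboolT// asboolF//= mul1r mulr0 addr0.
    rewrite asboolF// asboolT//= mul0r mulr1 add0r.
    by rewrite leNgt; apply/negP.
  rewrite leeD2r//; apply: le_expect => z _; exact: ler_pw.
(* Adding [P (~] B_n)[to both sides avoids a subtraction in the extended reals:]E(s^(Z_n); B_n) + P
   (~[B_n) <= 1]. *)
apply: (@le_trans _ _ (expect n (stays_in D n) (pw (width n) s) +
  theta%:E * P (~` stays_in D n) + P (~` stays_in D n))).
  by rewrite leeD2r.
rewrite addeAC leeD2r//.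
apply: (@le_trans _ _ (P (stays_in D n) + P (~` stays_in D n))).
  rewrite leeD2r// -[X in _ <= P X](_ : stays_in D n `&` [set w | setT (Z n w)] = _).
    rewrite (prob_expect hxi setT (past_stays_in D n)).
    by apply: le_expect => z _; rewrite asboolT// pw_le1.
  by rewrite (_ : [set w | _] = setT) ?setIT//; apply/seteqP.
rewrite probability_setC; last exact: stays_in_measurable.
by rewrite addeC subeK// fin_num_measure//; exact: stays_in_measurable.
Qed.

Lemma pwX m (s : nat -> R) z k : pw m (fun j => s j ^+ k)%R z = (pw m s z ^+ k)%R.
Proof.
by rewrite /pw -prodrXl; apply: eq_bigr => j _; rewrite exprAC.
Qed.

(** Put [W_n = sum_l Z_(n,l) v_l]. Off an event of probability O(1/k), [W_n] stays below [k + 1];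
    there the summability of [E(s^(Z_n); Z_(n,l) > 0)] allows Borel-Cantelli, and [k] is
    arbitrary. *)
Lemma partial_extinction_eq1_of_martingale (v : nat -> R) :
  (forall j, 0 < v j)%R ->
  (forall lam j, 0 < lam ->
    expR (- (lam * v j)) <= gf p (fun j => expR (- (lam * v j))) j)%R ->
  (forall l, exists s : nat -> R, [/\ (forall j, expR (- v j) <= s j <= 1)%R,
     (forall j, s j <= gf p s j)%R & (s l < gf p s l)%R]) ->
  partial_extinction P xi i0 = 1.
Proof.
move=> v0 gv hs; apply: (partial_extinction_eq1 hp hxi) => l.
have [s [s1 gs gsl]] := hs l.
have s01 j : (0 < s j <= 1)%R.
  by case/andP: (s1 j) => vs ->; rewrite (lt_le_trans (expR_gt0 _) vs).
pose t k j : R := expR (- ((k.+1%:R)^-1 * v j)).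
have t01 k j : (0 <= t k j <= 1)%R.
  by rewrite /t expR_ge0 expR_le1 oppr_le0 mulr_ge0 ?invr_ge0// ltW.
(* With [lam = 1 / (k + 1)], the condition [th < pw (width m) (t k) z] says that [W < k + 1] in the
   state [z]; hence [B k] is the event that [W_n] reaches [k + 1] at some time. *)
pose th : R := expR (-1).
pose D k m := [set z | (th < pw (width m) (t k) z)%R].
pose B k := \bigcup_n ~` stays_in (D k) n.
have mB k n : measurable (~` stays_in (D k) n).
  by apply: measurableC; exact: stays_in_measurable.
have mUB k : measurable (B k) by exact: bigcup_measurable.
have th1 : (0 < 1 - th)%R by rewrite subr_gt0 expR_lt1 oppr_lt0.
(* The maximal inequality gives [(1 - th) P(~ stays_in) <= 1 - t k i0], and [1 - exp (- x) <= x]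
   bounds the right side by [v i0 / (k + 1)]. *)
have PB k : P (B k) <= ((1 - th)^-1 * v i0 / k.+1%:R)%:E.
  have PBn n : P (~` stays_in (D k) n) <= ((1 - th)^-1 * v i0 / k.+1%:R)%:E.
    have gt j : (t k j <= gf p (t k) j)%R by apply: gv; rewrite invr_gt0.
    have := @maximal_ineq (t k) th n (t01 k) gt (expR_ge0 _).
    have /fineK <- : P (~` stays_in (D k) n) \is a fin_num by exact: fin_num_measure.
    rewrite -EFinM -!EFinD !lee_fin -mulrA ler_pdivlMl//.
    have : (1 - k.+1%:R^-1 * v i0 <= t k i0)%R.
      exact: expR_ge1Dx.
    rewrite mulrBl mul1r [(v i0 * _)%R]mulrC.
    set a := (_^-1 * v i0)%R; set b := fine _; set c := (th * b)%R; lra.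
  have cB : P (~` stays_in (D k) n) @[n --> \oo] --> P (B k).
    apply: nondecreasing_cvg_mu; [exact: mB|exact: mUB|].
    move=> m n /subnK <-; apply/subsetPset.
    elim: (n - m)%N => [|q IH]; first by rewrite add0n.
    by move=> w /IH hw [h _]; exact: hw.
  rewrite -(cvg_lim _ cB)//; apply: lime_le; first by apply/cvg_ex; eexists; exact: cB.
  exact: nearW.
(* On [D k n] one has [s^z >= exp (- W) = ((t k)^z)^(k + 1) >= exp (- (k + 1))], so the factor
   [exp (k + 1)] turns the summable expectations into bounds for the probabilities. *)
have sum k : \sum_(n <oo) P (visit xi i0 l n `&` [set w | D k n (Z n w)]) < +oo.
  apply: (@le_lt_trans _ _ (\sum_(n <oo) (expR k.+1%:R)%:E *
     expect n setT (fun z => (0 < z l)%N%:R * pw (width n) s z)%R)).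
    apply: lee_nneseries => [n _ _|n _]; first exact: measure_ge0.
    rewrite -[X in P X]setTI
      (prob_expect hxi (fun z => (0 < z l)%N /\ D k n z) (pastT hp hxi i0 n)).
    have pws z : (0 <= pw (width n) s z)%R.
      by apply: pw_ge0 => j; case/andP: (s01 j) => /ltW.
    rewrite -expectZ ?expR_ge0//; last by move=> z; rewrite mulr_ge0.
    apply: le_expect => z _; case: asboolP => [[zl Dz]|_]; last first.
      by rewrite !mulr_ge0 ?expR_ge0.
    rewrite zl mul1r.
    have : (pw (width n) (fun j => t k j ^+ k.+1) z <= pw (width n) s z)%R.
      apply: ler_pw => j; first by rewrite exprn_ge0 ?expR_ge0.
      case/andP: (s1 j) => + _; apply: le_trans.
      by rewrite /t -expRM_natl mulrN mulrA divff// mul1r.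
    rewrite pwX => /(ler_wpM2l (expR_ge0 k.+1%:R)); apply: le_trans.
    have : (th ^+ k.+1 <= pw (width n) (t k) z ^+ k.+1)%R.
      by rewrite lerXn2r ?nnegrE ?expR_ge0 ?(ltW Dz)// (le_trans (expR_ge0 _) (ltW Dz)).
    move=> /(ler_wpM2l (expR_ge0 k.+1%:R)); apply: le_trans.
    by rewrite /th -expRM_natl mulrN mulr1 -expRD subrr expR0.
  rewrite nneseriesZl; last first.
    move=> n _; apply: expect_ge0 => z; rewrite mulr_ge0// pw_ge0// => j.
    by case/andP: (s01 j) => /ltW.
  have := expect_visit_summable hp hxi i0 s01 gs gsl.
  set S := (\sum_(n <oo) _)%E => Soo.
  have S0 : 0 <= S.
    apply: nneseries_ge0 => n _ _; apply: expect_ge0 => z; rewrite mulr_ge0// pw_ge0// => j.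
    by case/andP: (s01 j) => /ltW.
  by rewrite lte_mul_pinfty// lee_fin expR_ge0.
have Pk k : P (lim_sup_set (visit xi i0 l)) <= ((1 - th)^-1 * v i0 / k.+1%:R)%:E.
  pose V n := visit xi i0 l n `&` [set w | D k n (Z n w)].
  have mV n : measurable (V n).
    apply: measurableI; first exact: (visit_measurable hp hxi).
    exact: (LHBP_measurable hp hxi).
  have mL : measurable (lim_sup_set V).
    by apply: bigcap_measurableType => n _; exact: bigcup_measurable.
  (* An outcome outside [B k] satisfies [D k n] for all [n], so its infinitely many visits to [l]
     all count in [V]. *)
  apply: (@le_trans _ _ (P (lim_sup_set V `|` B k))).
    apply: le_measure; rewrite ?inE//.
    - exact: (lim_sup_visit_measurable hp hxi).
    - exact: measurableU.
    move=> w hw; have [Bw|nBw] := pselect (B k w); [by right|left => n _].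
    have [j /= nj vj] := hw n I; exists j => //; split=> //.
    apply: contrapT => nD; apply: nBw; exists j.+1 => //= -[_]; exact: nD.
  apply: (@le_trans _ _ (P (lim_sup_set V) + P (B k))); first exact: measureU2.
  have -> : P (lim_sup_set V) = 0 by apply: lim_sup_set_cvg0 => //; exact: sum.
  by rewrite add0e.
apply/eqP; rewrite eq_le measure_ge0 andbT.
have /fineK PE : P (lim_sup_set (visit xi i0 l)) \is a fin_num.
  by apply: fin_num_measure; exact: (lim_sup_visit_measurable hp hxi).
rewrite -PE lee_fin; move: Pk; rewrite -PE; set x := fine _ => Pk.
rewrite leNgt; apply/negP => x0.
have c0 : (0 <= (1 - th)^-1 * v i0)%R by rewrite mulr_ge0 ?invr_ge0 ?ltW.
pose k := Num.bound ((1 - th)^-1 * v i0 / x)%R.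
have : ((1 - th)^-1 * v i0 / x < k%:R)%R.
  by apply: archi_boundP; rewrite divr_ge0// ltW.
rewrite ltNge => /negP; apply; have := Pk k.
rewrite lee_fin ler_pdivlMr// ler_pdivlMr// mulrC; apply: le_trans.
by rewrite ler_wpM2r ?ltW// ltr_nat.
Qed.
End maximal.

(** * Subinvariant vectors *)

Section propagation.
Context (R : realType).
Variables (Phi : (nat -> R) -> nat -> \bar R) (e : rel nat).
Variable dom : set (nat -> R).

Definition set_at (u : nat -> R) (i : nat) (t : R) (j : nat) : R :=
  if j == i then t else u j.

Definition subinvariant (u : nat -> R) := forall j, (u j)%:E <= Phi u j.

Definition strict_at (u : nat -> R) (j : nat) := (u j)%:E < Phi u j.

Hypothesis Phi_mono : forall u u', dom u -> dom u' ->
  (forall j, u j <= u' j)%R -> forall j, Phi u j <= Phi u' j.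
Hypothesis dom_set_at : forall u i t, dom u -> (u i < t)%R -> t%:E < Phi u i ->
  dom (set_at u i t).
Hypothesis Phi_edge : forall u u' i j, dom u -> dom u' ->
  (forall k, u k <= u' k)%R -> (u i < u' i)%R -> e j i ->
  (u j)%:E <= Phi u j -> (u j)%:E < Phi u' j.

(* Raising [u a] towards [Phi u a] keeps [u] subinvariant and makes strict every [j] with an
   edge to [a]. *)
Lemma strict_raise u a : dom u -> subinvariant u -> strict_at u a ->
  exists u', [/\ dom u' /\ subinvariant u', forall k, (u k <= u' k)%R,
    forall k, (u k < u' k)%R -> strict_at u' k,
    forall k, strict_at u k -> strict_at u' k & (u a < u' a)%R].
Proof.
move=> du su sta.
have [t /andP[ut tP]] : exists t : R, (u a < t)%R && (t%:E < Phi u a).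
  move: sta; rewrite /strict_at; case: (Phi u a) => [x| |] //.
    rewrite lte_fin => ux; exists ((u a + x) / 2)%R.
    by rewrite lte_fin midf_lt//= midf_lt.
  by move=> _; exists (u a + 1)%R; rewrite ltrDl ltr01 ltry.
pose u' := set_at u a t.
have u'a : u' a = t by rewrite /u' /set_at eqxx.
have u'E k : k != a -> u' k = u k by rewrite /u' /set_at => /negPf ->.
have uu' k : (u k <= u' k)%R.
  by have [->|/u'E->//] := eqVneq k a; rewrite u'a ltW.
have du' : dom u' by exact: dom_set_at.
have mono := Phi_mono du du' uu'.
have sta' : strict_at u' a by rewrite /strict_at u'a (lt_le_trans tP).
exists u'; split; [split=> // k|by []|move=> k|move=> k|by rewrite u'a].
- have [->|/u'E ->] := eqVneq k a; first exact: ltW.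
  exact: le_trans (mono k).
- by have [->|/u'E ->] := eqVneq k a; rewrite ?ltxx.
- have [->//|/u'E ka] := eqVneq k a.
  by rewrite /strict_at ka => /lt_le_trans; apply.
Qed.

(** Induction along the path from [j] to [i]: once the head of an edge is strict, raising it makes
    the tail strict. A tail that was raised itself is strict by the third clause. With [Phi]
    abstract, this serves both for [M v >= v] and for [G(s) >= s]. *)
Lemma strict_propagate u i j s :
  dom u -> subinvariant u -> strict_at u i -> path e j s -> last j s = i ->
  exists u', [/\ dom u' /\ subinvariant u', forall k, (u k <= u' k)%R,
    forall k, (u k < u' k)%R -> strict_at u' k,
    forall k, strict_at u k -> strict_at u' k & strict_at u' j].
Proof.
move=> du su; elim: s j => [|a s IH] j sti /=.
  by move=> _ ->; exists u; split=> // k; rewrite ltxx.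
move=> /andP[eja pas] las.
have [u1 [[du1 su1] uu1 ust1 st1 sta]] := IH a sti pas las.
have [u2 [[du2 su2] u12 ust2 st2 u12a]] := strict_raise du1 su1 sta.
exists u2; split=> //.
- by move=> k; exact: le_trans (u12 k).
- move=> k uk; have [u12k|u21k] := ltP (u1 k) (u2 k); first exact: ust2.
  by apply/st2/ust1; exact: lt_le_trans u21k.
- by move=> k /st1/st2.
- have [u12j|u21j] := ltP (u1 j) (u2 j); first exact: ust2.
  have -> : strict_at u2 j = ((u1 j)%:E < Phi u2 j).
    by rewrite /strict_at; congr (_%:E < _); apply/eqP; rewrite eq_le u21j u12.
  exact: Phi_edge du1 du2 u12 u12a eja (su1 j).
Qed.

End propagation.

(** The index [i] is split off; finiteness of the sum of [f] prevents the remaining terms from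
    absorbing the gap. *)
Lemma lte_esum (R : realType) (I : choiceType) (D : set I) (f g : I -> \bar R) i :
  D i -> (forall j, D j -> 0 <= f j) -> (forall j, D j -> f j <= g j) ->
  f i < g i -> \esum_(j in D) f j < +oo ->
  \esum_(j in D) f j < \esum_(j in D) g j.
Proof.
move=> Di f0 fg fgi.
have g0 j : D j -> 0 <= g j by move=> Dj; rewrite (le_trans (f0 j Dj))// fg.
rewrite (esumID [set i])// => foo; rewrite [ltRHS](esumID [set i])//.
have Dii : D `&` [set i] = [set i] by apply/seteqP; split=> [j []//|j ->].
move: foo; rewrite Dii !esum_set1 ?f0 ?g0// => foo.
set a := \esum_(j in _) f j in foo *; set b := \esum_(j in _) g j.
have ab : a <= b by apply: le_esum => j [Dj _]; exact: fg.
have a0 : 0 <= a by apply: esum_ge0 => j [Dj _]; exact: f0.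
have afin : a \is a fin_num.
  rewrite ge0_fin_numE//; apply: le_lt_trans foo.
  by rewrite leeDr// f0.
by rewrite lte_leD.
Qed.

Section linear.
Context (R : realType) (M : nat -> nat -> \bar R).
Hypothesis M0 : forall i j, 0 <= M i j.

(* [(M v)_i] for a lower Hessenberg matrix [M]. *)
Definition matvec (v : nat -> R) (i : nat) : \bar R :=
  \sum_(j < i.+2) M i j * (v j)%:E.

Definition finsupp_nonneg : set (nat -> R) :=
  [set v | (forall j, 0 <= v j)%R /\ exists K, forall j, (K <= j)%N -> v j = 0%R].

Lemma le_matvec u v : (forall j, u j <= v j)%R ->
  forall i, matvec u i <= matvec v i.
Proof. by move=> uv i; apply: lee_sum => j _; rewrite lee_wpmul2l ?lee_fin. Qed.

Lemma matvecD u v i : (forall j, 0 <= u j)%R -> (forall j, 0 <= v j)%R ->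
  matvec (fun j => u j + v j)%R i = matvec u i + matvec v i.
Proof.
move=> u0 v0; rewrite /matvec -big_split; apply: eq_bigr => j _ /=.
by rewrite EFinD ge0_muleDr ?lee_fin.
Qed.

Hypothesis Mhess : forall i j, (i.+1 < j)%N -> M i j = 0.

Lemma matvec_ge_entry v i j : (forall k, 0 <= v k)%R ->
  M i j * (v j)%:E <= matvec v i.
Proof.
move=> v0; have [ij|ij] := ltnP j i.+2; last first.
  by rewrite Mhess// mul0e sume_ge0// => k _; rewrite mule_ge0 ?lee_fin.
rewrite /matvec (bigD1 (Ordinal ij))//= leeDl// sume_ge0// => k _.
by rewrite mule_ge0 ?lee_fin.
Qed.

(** By additivity, [M v = M u + M (v - u)], and row [j] of the last term is at least
    [M j i * (v i - u i) > 0]. If row [j] of [M u] is infinite, strictness holds because [u j] is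
    finite. *)
Lemma matvec_edge u v i j : finsupp_nonneg u -> (forall k, u k <= v k)%R ->
  (u i < v i)%R -> 0 < M j i -> (u j)%:E <= matvec u j -> (u j)%:E < matvec v j.
Proof.
move=> [u0 _] uv uvi Mji uj.
have w0 k : (0 <= v k - u k)%R by rewrite subr_ge0.
have -> : v = (fun k => u k + (v k - u k))%R.
  by apply/funext => k; rewrite addrC subrK.
rewrite matvecD//.
have : 0 < matvec (fun k => v k - u k)%R j.
  apply: lt_le_trans (matvec_ge_entry j i w0).
  by rewrite mule_gt0// lte_fin subr_gt0.
move: uj (matvec _ j) => + y y0; case: (matvec u j) => [x| |]//= ux.
- by apply: (le_lt_trans ux); rewrite lteDl.
- by rewrite addye ?ltry//; case: y y0.
Qed.

Lemma finsupp_set_at u i t : finsupp_nonneg u -> (u i < t)%R ->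
  finsupp_nonneg (set_at u i t).
Proof.
move=> [u0 [K uK]] ut; split=> [j|].
  by rewrite /set_at; case: eqP => // _; rewrite (le_trans (u0 i))// ltW.
exists (maxn K i.+1) => j; rewrite geq_max => /andP[Kj ij].
by rewrite /set_at gtn_eqF// uK.
Qed.

Definition matvec_propagate u i j s := @strict_propagate R matvec
  (fun a b => 0 < M a b) finsupp_nonneg
  (fun u u' _ _ uu' => le_matvec uu')
  (fun u i t du ut _ => finsupp_set_at du ut)
  (fun u u' i j du _ => @matvec_edge u u' i j du) u i j s.

Definition matvec_raise u a := @strict_raise R matvec finsupp_nonneg
  (fun u u' _ _ uu' => le_matvec uu')
  (fun u i t du ut _ => finsupp_set_at du ut) u a.

Hypothesis Mirr : forall i j, exists s : seq nat,
  path (fun a b => 0 < M a b) i s /\ last i s = j.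

(* A vertex outside the support of [v] with an edge into it is strict. *)
Lemma strict_on_support v i0 :
  finsupp_nonneg v -> subinvariant matvec v -> (0 < v i0)%R ->
  exists u, [/\ finsupp_nonneg u, (0 < u i0)%R &
    forall i, (0 < u i)%R -> strict_at matvec u i].
Proof.
move=> dv sv vi0; have [v0 [K vK]] := dv.
have [i sti] : exists i, strict_at matvec v i.
  have [s [ps ls]] := Mirr K i0.
  have := vK K (leqnn K); elim: s K ps ls {vK} => [|a s IH] k /=.
    by move=> _ ki0; rewrite ki0 => v00; rewrite v00 ltxx in vi0.
  move=> /andP[Mka pas] las vk0.
  have [va0|va0] := eqVneq (v a) 0%R; first exact: IH va0.
  exists k; rewrite /strict_at vk0; apply: lt_le_trans (matvec_ge_entry _ a v0).
  by rewrite mule_gt0// lte_fin lt_neqAle eq_sym va0 v0.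
(* The indices below [K] are made strict one after another along paths to [i]. From [K] on [v]
   vanishes, so a positive entry of [u] there has been raised and is strict as well. *)
have [u [[du su] vu ust st uK]] : exists u,
    [/\ finsupp_nonneg u /\ subinvariant matvec u, forall k, (v k <= u k)%R,
     forall k, (v k < u k)%R -> strict_at matvec u k, strict_at matvec u i &
     forall k, (k < K)%N -> strict_at matvec u k].
  elim: {vK}K => [|m [u [[du su] vu ust st um]]].
    by exists v; split=> // k; rewrite ltxx.
  have [s [ps ls]] := Mirr m i.
  have [u' [[du' su'] uu' ust' st' stm]] := matvec_propagate du su st ps ls.
  exists u'; split=> //.
  - by move=> k; exact: le_trans (uu' k).
  - move=> k vu'; have [uk|uk] := ltP (u k) (u' k); first exact: ust'.
    by apply/st'/ust; exact: lt_le_trans uk.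
  - exact: st'.
  - by move=> k; rewrite ltnS leq_eqVlt => /predU1P[->//|/um]; exact: st'.
exists u; split=> //; first exact: lt_le_trans (vu i0).
move=> k uk; have [kK|Kk] := ltnP k K; first exact: uK.
by apply: ust; rewrite vK.
Qed.

End linear.

(** * Estimates of the generating functions at [exp (- v)] and near 1 *)

Section offspring_gf.
Context (R : realType) (p : nat -> (nat -> nat) -> R).
Hypothesis hp : offspring_law p.
Local Notation M := (mean_progeny p).

Let p0 i r : progeny i r -> (0 <= p i r)%R.
Proof. exact: law_ge0. Qed.

Lemma mean_progeny_ge0 i j : 0 <= M i j.
Proof. by apply: esum_ge0 => r ir; rewrite lee_fin mulr_ge0// p0. Qed.

Lemma mean_progeny_hess i j : (i.+1 < j)%N -> M i j = 0.
Proof. by move=> ij; apply: esum1 => r ->//; rewrite mulr0. Qed.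

Lemma mean_progeny_gt0 i j : 0 < M i j ->
  exists r, [/\ progeny i r, (0 < p i r)%R & (0 < r j)%N].
Proof.
move=> Mij; apply: contrapT => h.
have : M i j = 0; last by move=> M0; rewrite M0 ltxx in Mij.
apply: esum1 => r ir.
have [rj|] := ltnP 0 (r j); last by rewrite leqn0 => /eqP ->; rewrite mulr0.
have [pr|pr] := ltP 0%R (p i r); first by exfalso; apply: h; exists r.
have -> : p i r = 0%R by apply/eqP; rewrite eq_le pr p0.
by rewrite mul0r.
Qed.

Definition dot (m : nat) (v : nat -> R) (z : nat -> nat) : R :=
  (\sum_(l < m) (z l)%:R * v l)%R.

Lemma dot_ge0 m v z : (forall l, 0 <= v l)%R -> (0 <= dot m v z)%R.
Proof. by move=> v0; apply: sumr_ge0 => l _; rewrite mulr_ge0. Qed.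

Lemma matvec_mean v i : (forall l, 0 <= v l)%R ->
  matvec M v i = \esum_(r in progeny i) (p i r * dot i.+2 v r)%:E.
Proof.
move=> v0; rewrite /matvec /mean_progeny.
transitivity (\sum_(j < i.+2) \esum_(r in progeny i) (p i r * ((r j)%:R * v j))%:E).
  apply: eq_bigr => j _; rewrite muleC -ge0_esumZl//.
    by apply: eq_esum => r _; rewrite -EFinM mulrC mulrA.
  by move=> r ir; rewrite lee_fin mulr_ge0// p0.
rewrite -esum_sum; last first.
  by move=> r j ir _; rewrite lee_fin !mulr_ge0// p0.
by apply: eq_esum => r ir; rewrite sumEFin /dot mulr_sumr.
Qed.

Lemma pw_expR m v z : pw m (fun l => expR (- v l)) z = expR (- dot m v z).
Proof.
rewrite /pw /dot -sumrN expR_sum; apply: eq_bigr => l _.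
by rewrite -expRM_natl mulrN.
Qed.

Lemma expR_01 (v : nat -> R) l : (forall l, 0 <= v l)%R ->
  (0 <= expR (- v l) <= 1)%R.
Proof. by move=> v0; rewrite expR_ge0 expR_le1 oppr_le0 v0. Qed.

(* Jensen for [expR], through its tangent at [- v i]. *)
Lemma expR_tangent (a x : R) : (expR (- a) * (1 + a) <= expR (- x) + expR (- a) * x)%R.
Proof.
have -> : (- x = - a + (a - x))%R by rewrite addrA addNr add0r.
rewrite expRD -mulrDr ler_wpM2l ?expR_ge0//.
by rewrite -lerBlDr -addrA expR_ge1Dx.
Qed.

Lemma expR_tangent_lt (a x : R) : x != a ->
  (expR (- a) * (1 + a) < expR (- x) + expR (- a) * x)%R.
Proof.
move=> xa; have -> : (- x = - a + (a - x))%R by rewrite addrA addNr add0r.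
rewrite expRD -mulrDr ltr_pM2l ?expR_gt0//.
by rewrite -ltrBlDr -addrA expR_gt1Dx// subr_eq0 eq_sym.
Qed.

Let esum_p i (c : R) : (0 <= c)%R ->
  \esum_(r in progeny i) (p i r * c)%:E = c%:E.
Proof.
move=> c0; have [_ p1] := hp i.
rewrite -[RHS]mule1 -p1 -ge0_esumZl//; last by move=> r /p0; rewrite lee_fin.
by apply: eq_esum => r _; rewrite -EFinM mulrC.
Qed.

(** The mean of the right-hand side of [expR_tangent] at [a = v i], with [x] the total weight of the
    progeny. *)
Let gf_matvec v i : (forall l, 0 <= v l)%R ->
  \esum_(r in progeny i) (p i r * (expR (- dot i.+2 v r) +
      expR (- v i) * dot i.+2 v r))%:E =
  (gf p (fun l => expR (- v l)) i)%:E + (expR (- v i))%:E * matvec M v i.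
Proof.
move=> v0; rewrite -gfE//; last by move=> l; exact: expR_01.
rewrite matvec_mean// -ge0_esumZl ?expR_ge0//; last first.
  by move=> r ir; rewrite lee_fin mulr_ge0 ?p0// dot_ge0.
rewrite -esumD; last 2 first.
- by move=> r ir; rewrite lee_fin mulr_ge0 ?p0// pw_ge0// => l; rewrite expR_ge0.
- move=> r ir; rewrite mule_ge0 ?lee_fin ?expR_ge0// mulr_ge0 ?p0// dot_ge0//.
by apply: eq_esum => r ir; rewrite pw_expR -EFinM -EFinD; congr EFin; ring.
Qed.

Lemma gf_expR_ge v i : (forall l, 0 <= v l)%R -> matvec M v i <= (v i)%:E ->
  (expR (- v i) <= gf p (fun l => expR (- v l)) i)%R.
Proof.
move=> v0 Mv.
have h : (expR (- v i) * (1 + v i))%:E <=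
   (gf p (fun l => expR (- v l)) i)%:E + (expR (- v i))%:E * matvec M v i.
  rewrite -gf_matvec// -(esum_p i); last by rewrite mulr_ge0 ?expR_ge0// addr_ge0.
  by apply: le_esum => r ir; rewrite lee_fin ler_wpM2l ?p0// expR_tangent.
have : (expR (- v i))%:E * matvec M v i <= (expR (- v i))%:E * (v i)%:E.
  by rewrite lee_wpmul2l// lee_fin expR_ge0.
move=> /(leeD2l (gf p (fun l => expR (- v l)) i)%:E) /(le_trans h).
by rewrite -EFinM -EFinD lee_fin mulrDr mulr1 lerD2r.
Qed.

(** The averaged tangent inequality is strict because the progeny [r], of positive probability, has
    a weight different from the point of tangency [v i]. *)
Lemma gf_expR_gt v i r : (forall l, 0 <= v l)%R -> matvec M v i <= (v i)%:E ->
  progeny i r -> (0 < p i r)%R -> dot i.+2 v r != v i ->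
  (expR (- v i) < gf p (fun l => expR (- v l)) i)%R.
Proof.
move=> v0 Mv ir pr rv.
have vi0 : (0 <= expR (- v i) * (1 + v i))%R by rewrite mulr_ge0 ?expR_ge0// addr_ge0.
have h : (expR (- v i) * (1 + v i))%:E <
   (gf p (fun l => expR (- v l)) i)%:E + (expR (- v i))%:E * matvec M v i.
  rewrite -gf_matvec// -(esum_p i)//; apply: (@lte_esum _ _ _ _ _ r) => //.
  - by move=> r' ir'; rewrite lee_fin mulr_ge0// p0.
  - by move=> r' ir'; rewrite lee_fin ler_wpM2l ?p0// expR_tangent.
  - by rewrite lte_fin ltr_pM2l// expR_tangent_lt.
  - by rewrite esum_p// ltry.
have : (expR (- v i))%:E * matvec M v i <= (expR (- v i))%:E * (v i)%:E.
  by rewrite lee_wpmul2l// lee_fin expR_ge0.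
move=> /(leeD2l (gf p (fun l => expR (- v l)) i)%:E) /(lt_le_trans h).
by rewrite -EFinM -EFinD lte_fin mulrDr mulr1 ltrD2r.
Qed.

Lemma le_gf s s' i : (forall l, 0 <= s l <= 1)%R -> (forall l, 0 <= s' l <= 1)%R ->
  (forall l, s l <= s' l)%R -> (gf p s i <= gf p s' i)%R.
Proof.
move=> s01 s01' ss'; rewrite -lee_fin -!gfE//; apply: le_esum => r ir.
rewrite lee_fin ler_wpM2l ?p0// ler_pw// => l.
by case/andP: (s01 l).
Qed.

Lemma lt_gf s s' i j : (forall l, 0 < s l <= 1)%R -> (forall l, 0 < s' l <= 1)%R ->
  (forall l, s l <= s' l)%R -> (s j < s' j)%R -> 0 < M i j ->
  (gf p s i < gf p s' i)%R.
Proof.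
move=> s01 s01' ss' sj /mean_progeny_gt0[r [ir pr rj]].
have s0 l : (0 < s l)%R by case/andP: (s01 l).
have w (t : nat -> R) : (forall l, 0 < t l <= 1)%R -> forall l, (0 <= t l <= 1)%R.
  by move=> t01 l; case/andP: (t01 l) => /ltW -> ->.
have ji : (j < i.+2)%N by rewrite ltnNge; apply/negP => /ir h; rewrite h in rj.
rewrite -lte_fin -!gfE//; try exact: w.
apply: (@lte_esum _ _ _ _ _ r) => //.
- by move=> r' ir'; rewrite lee_fin mulr_ge0 ?p0// pw_ge0// => l; exact: ltW.
- by move=> r' ir'; rewrite lee_fin ler_wpM2l ?p0// ler_pw// => l; exact: ltW.
- by rewrite lte_fin ltr_pM2l//; exact: (ltr_pw s0 ss' ji rj sj).
- by rewrite gfE ?ltry//; exact: w.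
Qed.

(* [1 - e^-x >= x / (1 + x)] bounds [1 - gf (1 - eps u)] below, over the finitely many
   progenies that already make the mean exceed [u i]. *)
Lemma gf_near1_le u i : (forall l, 0 <= u l)%R -> strict_at (matvec M) u i ->
  exists2 e0 : R, (0 < e0)%R & forall e : R, (0 < e <= e0)%R ->
    (forall l, e * u l <= 1)%R -> (gf p (fun l => 1 - e * u l) i <= 1 - e * u i)%R.
Proof.
move=> u0; rewrite /strict_at matvec_mean// => /ereal_sup_gt[_ [X [finX Xi] <-]].
pose Y := finmap.enum_fset (fset_set X).
have memX r : r \in Y -> progeny i r.
  by move=> rY; apply: Xi; apply: set_mem; rewrite -(in_fset_set finX r).
rewrite fsbig_finite//= -/Y sumEFin lte_fin; set A := (\sum_(r <- _) _)%R => uA.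
pose B := (\sum_(r <- Y) dot i.+2 u r)%R.
have B0 : (0 <= B)%R by apply: sumr_ge0 => r _; exact: dot_ge0.
have rB r : r \in Y -> (dot i.+2 u r <= B)%R.
  move=> rX; rewrite /B (big_rem r)//= lerDl; apply: sumr_ge0 => r' _; exact: dot_ge0.
have d0 : (0 < B * u i + 1)%R by rewrite ltr_wpDl// mulr_ge0.
(* This threshold ensures [u i * (1 + e * B) <= A]. Here [A > u i] is the mean weight restricted to
   the finite set [Y], and [B] bounds the weight of each progeny in [Y]. *)
exists ((A - u i) / (B * u i + 1))%R; first by rewrite divr_gt0// subr_gt0.
move=> e /andP[e0 ee0] eu1.
have s01 l : (0 <= 1 - e * u l <= 1)%R.
  by rewrite subr_ge0 eu1/= gerBl mulr_ge0// ltW.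
set s := fun l => _ in s01 *.
have pw1 r : (0 <= 1 - pw i.+2 s r)%R by rewrite subr_ge0 pw_le1.
have tot : (gf p s i)%:E + \esum_(r in progeny i) (p i r * (1 - pw i.+2 s r))%:E = 1.
  rewrite -gfE// -esumD; last 2 first.
  - move=> r ir; rewrite lee_fin mulr_ge0 ?p0// pw_ge0// => l.
    by case/andP: (s01 l).
  - by move=> r ir; rewrite lee_fin mulr_ge0 ?p0.
  rewrite -[RHS](esum_p i ler01); apply: eq_esum => r ir.
  by rewrite -EFinD; congr EFin; ring.
have low : (e * u i)%:E <= \esum_(r in progeny i) (p i r * (1 - pw i.+2 s r))%:E.
  apply: esum_ge; exists X => //; rewrite fsbig_finite//= -/Y sumEFin lee_fin.
  have eB : (0 < 1 + e * B)%R by rewrite ltr_pwDl// mulr_ge0// ltW.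
  apply: (@le_trans _ _ (e * A / (1 + e * B))%R).
    rewrite ler_pdivlMr// -mulrA ler_pM2l//.
    move: ee0; rewrite ler_pdivlMr//.
    have -> : (u i * (1 + e * B) = e * (B * u i + 1) + u i - e)%R by ring.
    by set x := (e * _)%R; lra.
  rewrite /A mulr_sumr mulr_suml big_seq [leRHS]big_seq.
  apply: ler_sum => r rX.
  rewrite -[leLHS](_ : p i r * (e * dot i.+2 u r / (1 + e * B)) = _)%R; last by ring.
  rewrite ler_wpM2l ?p0//; first exact: memX.
  have S0 : (0 <= e * dot i.+2 u r)%R by rewrite mulr_ge0 ?(ltW e0)// dot_ge0.
  have SB : (e * dot i.+2 u r <= e * B)%R by rewrite ler_pM2l// rB.
  have pwS : (pw i.+2 s r <= expR (- (e * dot i.+2 u r)))%R.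
    have -> : (e * dot i.+2 u r = dot i.+2 (fun l => e * u l) r)%R.
      by rewrite /dot mulr_sumr; apply: eq_bigr => l _; ring.
    rewrite -pw_expR; apply: ler_pw => l; first by case/andP: (s01 l).
    exact: expR_ge1Dx.
  (* The chain is [1 - s^r >= 1 - exp (- S) >= 1 - 1 / (1 + S) = S / (1 + S) >= S / (1 + e * B)]. *)
  set S := (e * dot _ _ _)%R in S0 SB pwS *.
  apply: (@le_trans _ _ (1 - expR (- S))%R); last by rewrite lerB.
  apply: (@le_trans _ _ (1 - (1 + S)^-1)%R); last first.
    by rewrite lerB// expRN lef_pV2 ?posrE ?expR_gt0 ?ltr_pwDl// expR_ge1Dx.
  apply: (@le_trans _ _ (S / (1 + S))%R).
    by rewrite ler_wpM2l// lef_pV2 ?posrE//; lra.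
  by rewrite le_eqVlt; apply/orP; left; apply/eqP; field; lra.
move: tot low; set S := \esum_(r in _) _.
case: S => [x| |]//; rewrite -EFinD lee_fin => -[] <- ?; lra.
Qed.

End offspring_gf.

(** * The recursion for [x_k] and [mu_k] *)

Section recursion.
Context (R : realType) (M : nat -> nat -> \bar R).
Hypothesis M0 : forall i j, 0 <= M i j.

Definition weight (j : nat) : R := (\prod_(i < j) fine (mu_ M i))^-1%R.

Definition mu_pos (k : nat) := forall j, (j < k)%N ->
  mu_ M j = (fine (mu_ M j))%:E /\ (0 < fine (mu_ M j))%R.

Lemma weight_gt0 k : mu_pos k -> (0 < weight k)%R.
Proof.
by move=> muk; rewrite invr_gt0; apply: prodr_gt0 => i _; case: (muk i).
Qed.

(** The product [m_(i -> k-1)] equals [w_i / w_k] for [w = weight]. The right side is thus row [k]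
    of [M w] without its superdiagonal term. *)
Lemma x_weight k : mu_pos k ->
  x_ M k * (weight k)%:E = \sum_(i < k.+1) M k i * (weight i)%:E.
Proof.
move=> muk; rewrite x_E ge0_sume_distrl; last first.
  move=> i _; rewrite mule_ge0// big_nat_cond prode_ge0// => j.
  by rewrite andbT => /andP[_ /muk[-> /ltW]]; rewrite lee_fin.
apply: eq_bigr => i _; rewrite -muleA; congr (_ * _).
have -> : \prod_(i <= j < k) mu_ M j = (\prod_(i <= j < k) fine (mu_ M j))%:E.
  rewrite -prodEFin big_nat_cond [RHS]big_nat_cond; apply: eq_bigr => j.
  by rewrite andbT => /andP[_ /muk[]].
rewrite -EFinM; congr EFin; rewrite /weight.
rewrite -!(big_mkord xpredT (fun j => fine (mu_ M j))).
have ik : (i <= k)%N by rewrite -ltnS.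
rewrite (big_cat_nat (leq0n i) ik)/= invfM mulrCA divff ?mulr1//.
rewrite gt_eqF// big_nat_cond prodr_gt0// => j.
by rewrite andbT => /andP[_ /muk[]].
Qed.

Hypothesis Mfin : forall i j, M i j < +oo.
Hypothesis Msup : forall i, 0 < M i i.+1.

Let MfinE i j : M i j = (fine (M i j))%:E.
Proof. by rewrite fineK// ge0_fin_numE. Qed.

Let muE k : 0 <= x_ M k < 1 ->
  mu_ M k = (fine (M k k.+1) / (1 - fine (x_ M k)))%:E /\ (fine (x_ M k) < 1)%R.
Proof.
rewrite /mu_; case: (x_ M k) => [x| |]; rewrite ?lte_fin//= ?andbF// => /andP[_ x1].
rewrite MfinE -EFinB inver subr_eq0 gt_eqF// -EFinM; split=> //.
Qed.

Lemma mu_posP k : (forall j, (j < k)%N -> 0 <= x_ M j < 1) -> mu_pos k.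
Proof.
move=> xk j jk; have [-> x1] := muE (xk j jk); split=> //=.
by rewrite divr_gt0 ?subr_gt0// -lte_fin -MfinE.
Qed.

(** The superdiagonal term is [M_(k,k+1) w_(k+1) = M_(k,k+1) w_k / mu_k = (1 - x_k) w_k], which
    complements the [x_k w_k] of [x_weight]. *)
Lemma matvec_weight k : (forall j, (j <= k)%N -> 0 <= x_ M j < 1) ->
  matvec M weight k = (weight k)%:E.
Proof.
move=> xk; have muk : mu_pos k by apply: mu_posP => j /ltnW; exact: xk.
rewrite /matvec big_ord_recr /= -x_weight//.
have xk01 := xk k (leqnn k); have [muE' x1] := muE xk01.
have /fineK <- : x_ M k \is a fin_num.
  by rewrite ge0_fin_numE; case/andP: xk01 => // _ /lt_trans -> //; exact: ltry.
rewrite MfinE -!EFinM -EFinD; congr EFin.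
have m0 : (0 < fine (M k k.+1))%R by rewrite -lte_fin -MfinE.
rewrite {2}/weight big_ord_recr /= muE' /= invfM -/(weight k).
by field; rewrite !gt_eqF// subr_gt0.
Qed.

End recursion.

(** * Necessity: almost sure partial extinction forces every [x_k] into [0, 1) *)

Section lhbp.
Context (R : realType) (d : measure_display) (T : measurableType d).
Context (P : probability T R) (p : nat -> (nat -> nat) -> R).
Context (xi : nat -> nat -> nat -> T -> nat -> nat).
Hypothesis hp : offspring_law p.
Hypothesis hxi : offspring_family P p xi.
Local Notation M := (mean_progeny p).
Hypothesis Msup : forall i, 0 < M i i.+1.
Hypothesis hirr : irreducible p.

Let M0 := mean_progeny_ge0 hp.
Let Mhess := @mean_progeny_hess R p.

Lemma partial_extinction_lt1 v i0 :
  finsupp_nonneg v -> subinvariant (matvec M) v -> (0 < v i0)%R ->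
  partial_extinction P xi i0 < 1.
Proof.
move=> dv sv vi0.
have [u [[u0 [K uK]] ui0 ust]] := strict_on_support M0 Mhess hirr dv sv vi0.
(* [U] bounds all entries of [u], so that [e <= 1 / U] keeps [1 - e * u l] in [0, 1]. *)
pose U := (1 + \sum_(l < K) u l)%R.
have U0 : (0 < U)%R by rewrite ltr_pwDl// sumr_ge0.
have uU l : (u l <= U)%R.
  have [lK|Kl] := ltnP l K; last by rewrite uK// ltW.
  rewrite /U (bigD1 (Ordinal lK))//= addrCA lerDl addr_ge0// sumr_ge0//.
have [e [e0 eU]] : exists e : R, [/\ (0 < e)%R, (e <= U^-1)%R &
    forall i, (i < K)%N -> (gf p (fun l => 1 - e * u l) i <= 1 - e * u i)%R].
  suff [e0 e0_gt0 he] : exists2 e0 : R, (0 < e0)%R & forall e : R,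
      (0 < e <= e0)%R -> (e <= U^-1)%R -> forall i, (i < K)%N ->
      (gf p (fun l => 1 - e * u l) i <= 1 - e * u i)%R.
    exists (Num.min e0 U^-1)%R; rewrite lt_min e0_gt0 invr_gt0 U0; split=> //.
      by rewrite ge_min lexx orbT.
    apply: he; last by rewrite ge_min lexx orbT.
    by rewrite lt_min e0_gt0 invr_gt0 U0 ge_min lexx.
  have eu1 (e : R) : (0 < e)%R -> (e <= U^-1)%R -> forall l, (e * u l <= 1)%R.
    move=> e0 eU l; rewrite -(mulVf (lt0r_neq0 U0)).
    by apply: ler_pM => //; exact: ltW.
  (* The least of finitely many thresholds is taken; where [u m = 0], the inequality only says that
     the generating function is at most 1. *)
  elim: (K) => [|m [e0 e0_gt0 he]]; first by exists 1%R.
  have [um|um] := ltP 0%R (u m).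
    have [e1 e1_gt0 he1] := gf_near1_le hp u0 (ust m um).
    exists (Num.min e0 e1)%R; first by rewrite lt_min e0_gt0.
    move=> e /andP[e_gt0]; rewrite le_min => /andP[ee0 ee1] eU i.
    rewrite ltnS leq_eqVlt => /predU1P[->|]; last by apply: he => //; rewrite e_gt0.
    by apply: he1; rewrite ?e_gt0//; exact: eu1.
  exists e0 => // e ee0 eU i; rewrite ltnS leq_eqVlt => /predU1P[->|]; last exact: he.
  have -> : u m = 0%R by apply/eqP; rewrite eq_le um u0.
  rewrite mulr0 subr0; case/andP: ee0 => e_gt0 _.
  have s01 l : (0 <= 1 - e * u l <= 1)%R.
    by rewrite subr_ge0 eu1//= gerBl mulr_ge0// ltW.
  by case/andP: (gf_ge0_le1 hp m s01).
move=> gfs.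
have s01 l : (0 <= 1 - e * u l <= 1)%R.
  rewrite gerBl mulr_ge0// ?(ltW e0)// andbT subr_ge0 -(mulVf (lt0r_neq0 U0)).
  by apply: ler_pM => //; exact: ltW.
apply: (@le_lt_trans _ _ (1 - e * u i0)%:E).
  apply: (@partial_extinction_le _ _ _ P p xi hp hxi i0 K (fun l => 1 - e * u l)%R) => //.
    by move=> l /uK ->; rewrite mulr0 subr0.
  move=> l; have [lK|Kl] := ltnP l K; first exact: gfs.
  by rewrite uK// mulr0 subr0; case/andP: (gf_ge0_le1 hp l s01).
by rewrite lte_fin gtrBl mulr_gt0.
Qed.

Hypothesis hext : forall i, partial_extinction P xi i = 1.

Lemma mean_fin_of_extinction a b : M a b < +oo.
Proof.
rewrite ltey; apply/eqP => Mab.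
(* With [2] at [(a, a)] the indicator of [a] is subinvariant and strict at [a]; enlarged to
   be positive at [b], it is subinvariant for [M] as well because [M a b = +oo]. *)
pose M' i j : \bar R := if (i == a) && (j == a) then 2%:E else M i j.
have M'0 i j : 0 <= M' i j by rewrite /M'; case: ifP.
have M'hess i j : (i.+1 < j)%N -> M' i j = 0.
  rewrite /M' => ij; case: ifP => [/andP[/eqP ia /eqP ja]|_]; last exact: Mhess.
  by rewrite ia ja ltnNge leqnSn in ij.
have M'a i v : i != a -> matvec M' v i = matvec M v i.
  by move=> ia; apply: eq_bigr => j _; rewrite /M' (negPf ia).
pose v j : R := (j == a)%:R.
have v0 j : (0 <= v j)%R by [].
have dv : finsupp_nonneg v.
  by split=> //; exists a.+1 => j aj; rewrite /v gtn_eqF.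
have sta : strict_at (matvec M') v a.
  apply: lt_le_trans (matvec_ge_entry M'0 M'hess a a v0).
  by rewrite /M' /v eqxx mule1 lte_fin ltr1n.
have sv : subinvariant (matvec M') v.
  move=> j; have [->|ja] := eqVneq j a; first exact: ltW.
  by rewrite {1}/v (negPf ja) sume_ge0// => k _; rewrite mule_ge0 ?lee_fin.
have [s [ps ls]] := hirr b a.
have {}ps : path (fun i j => 0 < M' i j) b s.
  apply: sub_path ps => i j Mij.
  have [ij|nij] := boolP ((i == a) && (j == a)).
    by rewrite /M' ij lte_fin ltr0n.
  by rewrite /M' (negPf nij).
have [u [[du su] vu _ _ stb]] := matvec_propagate M'0 M'hess dv sv sta ps ls.
have [u' [[du' su'] uu' _ _ ub]] := matvec_raise M'0 du su stb.
have u'b : (0 < u' b)%R by apply: le_lt_trans ub; case: du.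
have u'a : (0 < u' a)%R.
  by rewrite (lt_le_trans _ (uu' a))// (lt_le_trans _ (vu a))// /v eqxx.
suff : partial_extinction P xi a < 1 by rewrite hext ltxx.
apply: (partial_extinction_lt1 du' _ u'a) => j.
have [->|ja] := eqVneq j a; last by rewrite -M'a.
apply: le_trans (matvec_ge_entry M0 Mhess a b (proj1 du')).
by rewrite Mab gt0_mulye ?leey// lte_fin.
Qed.

Lemma x_of_extinction k : 0 <= x_ M k < 1.
Proof.
have Mfin := mean_fin_of_extinction.
elim/ltn_ind: k => k IH.
have muk : mu_pos M k by apply: mu_posP.
have w0 : (0 < weight M k)%R by exact: weight_gt0.
have Ek := x_weight M0 muk.
have wpos j : (j <= k)%N -> (0 < weight M j)%R.
  by move=> jk; apply: weight_gt0 => i ij; apply: muk; exact: leq_trans jk.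
have xk0 : 0 <= x_ M k.
  rewrite -(@pmule_lge0 _ (weight M k)%:E) ?lte_fin// Ek sume_ge0// => i _.
  by rewrite mule_ge0// lee_fin ltW// wpos// -ltnS.
rewrite xk0 /= ltNge; apply/negP => xk1.
(* Rows before [k] involve only entries up to [k], so truncation leaves them exact. Row [k] loses
   its superdiagonal term and equals [x_k w_k >= w_k]. Beyond [k] the vector is 0. *)
pose v j : R := if (j <= k)%N then weight M j else 0%R.
have v0 j : (0 <= v j)%R by rewrite /v; case: ifP => // jk; exact/ltW/wpos.
have vk : (0 < v k)%R by rewrite /v leqnn.
have dv : finsupp_nonneg v by split=> //; exists k.+1 => j kj; rewrite /v leqNgt kj.
suff : partial_extinction P xi k < 1 by rewrite hext ltxx.
apply: (partial_extinction_lt1 dv _ vk) => j.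
case: (ltngtP j k) => [jk|kj|->].
- have -> : matvec M v j = matvec M (weight M) j.
    apply: eq_bigr => i _; rewrite /v ifT//.
    by rewrite -ltnS (leq_trans (ltn_ord i)).
  rewrite matvec_weight//; first by rewrite /v (ltnW jk).
  by move=> i ij; apply: IH; exact: leq_ltn_trans jk.
- by rewrite {1}/v leqNgt kj sume_ge0// => i _; rewrite mule_ge0 ?lee_fin.
- rewrite /matvec big_ord_recr /= {3}/v ltnn mule0 adde0.
  have -> : \sum_(i < k.+1) M k i * (v i)%:E = x_ M k * (weight M k)%:E.
    by rewrite Ek; apply: eq_bigr => i _; rewrite /v -ltnS ltn_ord.
  by rewrite /v leqnn -[leLHS]mul1e lee_wpmul2r// lee_fin ltW.
Qed.

End lhbp.

(** * Finite means when every [x_k] lies in [0, 1) *)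

Section mean_finite.
Context (R : realType) (M : nat -> nat -> \bar R).
Hypothesis M0 : forall i j, 0 <= M i j.
Hypothesis Mhess : forall i j, (i.+1 < j)%N -> M i j = 0.
Hypothesis Msup : forall i, 0 < M i i.+1.
Hypothesis Mirr : forall i j, exists s : seq nat,
  path (fun a b => 0 < M a b) i s /\ last i s = j.
Hypothesis x01 : forall k, 0 <= x_ M k < 1.

Let mu_factor k : exists2 c : R, (0 < c)%R & mu_ M k = M k k.+1 * c%:E.
Proof.
have := x01 k; rewrite /mu_; case: (x_ M k) => [x| |]; rewrite ?andbF// lte_fin.
move=> /andP[_ x1]; exists (1 - x)^-1%R; first by rewrite invr_gt0 subr_gt0.
by rewrite -EFinB inver subr_eq0 gt_eqF.
Qed.

Let mu_gt0 k : 0 < mu_ M k.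
Proof. by have [c c0 ->] := mu_factor k; rewrite mule_gt0. Qed.

Let prod_mu_gt0 i k : 0 < \prod_(i <= j < k) mu_ M j.
Proof. by apply: (big_ind (fun x => 0 < x)) => // x y; exact: mule_gt0. Qed.

Let x_ge i k : (i <= k)%N -> M k i * \prod_(i <= j < k) mu_ M j <= x_ M k.
Proof.
move=> ik; rewrite x_E (bigD1 (Ordinal (ik : (i < k.+1)%N)))//= leeDl//.
by rewrite sume_ge0// => j _; rewrite mule_ge0// ltW.
Qed.

(** An infinite entry on or below the diagonal makes [x_a] infinite. An infinite superdiagonal entry
    makes [mu_a] infinite, and [mu_a] is then a factor of a positive term of some later [x_l]. *)
Lemma mean_fin_of_x a b : M a b < +oo.
Proof.
rewrite ltey; apply/eqP => Mab.
have x_noty k : x_ M k != +oo.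
  by have := x01 k; case: (x_ M k) => //; rewrite andbF.
have [ba|ab] := leqP b a.
  have := x_ge ba; rewrite Mab gt0_mulye// leye_eq => /eqP xa.
  by have := x_noty a; rewrite xa eqxx.
have b_eq : b = a.+1.
  apply/eqP; rewrite eqn_leq ab andbT leqNgt; apply/negP => /Mhess.
  by rewrite Mab.
have mua : mu_ M a = +oo.
  by have [c c0 ->] := mu_factor a; rewrite -b_eq Mab gt0_mulye.
(* A path from [a + 1] back to [a] must contain an edge from above [a] to [a] or below; the
   corresponding product in [x_l] runs over [mu_a]. *)
have [l [j [al ja Mlj]]] : exists l j, [/\ (a < l)%N, (j <= a)%N & 0 < M l j].
  suff cross s k : (a < k)%N -> path (fun i j => 0 < M i j) k s -> last k s = a ->
      exists l j, [/\ (a < l)%N, (j <= a)%N & 0 < M l j].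
    by have [s [ps ls]] := Mirr a.+1 a; exact: cross (ltnSn a) ps ls.
  elim: s k => [|c s IH] k ak /=.
    by move=> _ ka; rewrite ka ltnn in ak.
  move=> /andP[Mkc pcs] lcs; have [ca|ac] := leqP c a; first by exists k, c.
  exact: IH ac pcs lcs.
have jl : (j <= l)%N by exact: leq_trans ja (ltnW al).
have := x_ge jl.
rewrite (big_cat_nat (n := a))//= ?(ltnW al)//.
rewrite [X in _ * (_ * X)](big_ltn al) mua.
rewrite gt0_mulye// gt0_muley// gt0_muley// leye_eq => /eqP xl.
by have := x_noty l; rewrite xl eqxx.
Qed.

End mean_finite.

(** * Sufficiency: almost sure partial extinction when every [x_k] lies in [0, 1) *)

Section converse.
Context (R : realType) (d : measure_display) (T : measurableType d).
Context (P : probability T R) (p : nat -> (nat -> nat) -> R).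
Context (xi : nat -> nat -> nat -> T -> nat -> nat).
Hypothesis hp : offspring_law p.
Hypothesis hxi : offspring_family P p xi.
Hypothesis hns : non_singular p.
Local Notation M := (mean_progeny p).
Hypothesis Msup : forall i, 0 < M i i.+1.
Hypothesis hirr : irreducible p.

Let M0 := mean_progeny_ge0 hp.
Let Mhess := @mean_progeny_hess R p.

(** Otherwise every possible progeny carries exactly the weight of its parent. No child is then
    heavier than its parent, so irreducibility makes [v] constant, and every progeny has size 1,
    against non-singularity. *)
Lemma non_deterministic_progeny (v : nat -> R) : (forall j, 0 < v j)%R ->
  exists i r, [/\ progeny i r, (0 < p i r)%R & dot i.+2 v r != v i].
Proof.
move=> v0; apply: contrapT => h.
have dotE i r : progeny i r -> (0 < p i r)%R -> dot i.+2 v r = v i.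
  by move=> ir pr; apply/eqP; apply: contrapT => /negP ?; apply: h; exists i, r.
have vle i j : 0 < M i j -> (v j <= v i)%R.
  move=> /(mean_progeny_gt0 hp)[r [ir pr rj]].
  have ji : (j < i.+2)%N by rewrite ltnNge; apply/negP => /ir h'; rewrite h' in rj.
  rewrite -(dotE i r ir pr) /dot (bigD1 (Ordinal ji))//=.
  rewrite -[leLHS]addr0 lerD//; last first.
    by apply: sumr_ge0 => l _; rewrite mulr_ge0// ltW.
  by rewrite ler_peMl ?ler1n// ltW.
have vle' i j : (v j <= v i)%R.
  have [s [ps <-]] := hirr i j.
  elim: s i ps => [|a s IH] i //= /andP[Mia pas].
  exact: le_trans (IH a pas) (vle _ _ Mia).
have vE i : v i = v 0%N by apply/eqP; rewrite eq_le !vle'.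
have [i] := hns; rewrite esum_mkcondr.
suff -> : \esum_(r in progeny i) (if r \in [set r | progeny_size i r = 1%N]
    then (p i r)%:E else 0) = 1 by rewrite ltxx.
have [_ <-] := hp i; apply: eq_esum => r ir.
have [pr|pr] := ltP 0%R (p i r); last first.
  have -> : p i r = 0%R by apply/eqP; rewrite eq_le pr (law_ge0 hp).
  by case: ifP.
rewrite mem_set//; apply/eqP; rewrite -(eqr_nat R); apply/eqP.
apply: (mulIf (lt0r_neq0 (v0 0%N))); rewrite mul1r -[RHS](vE i) -(dotE i r ir pr).
rewrite /progeny_size natr_sum mulr_suml; apply: eq_bigr => l _.
by rewrite vE.
Qed.

Lemma extinction_of_x i0 : (forall k, 0 <= x_ M k < 1) ->
  partial_extinction P xi i0 = 1.
Proof.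
move=> x01; have Mfin := mean_fin_of_x M0 Mhess Msup hirr x01.
pose w := weight M.
have w0 j : (0 < w j)%R by apply: weight_gt0; apply: mu_posP.
have Mw i : matvec M w i = (w i)%:E by apply: matvec_weight.
have w0' j : (0 <= w j)%R by exact: ltW.
apply: (@partial_extinction_eq1_of_martingale _ _ _ P p xi hp hxi i0 w w0) => [lam j lam0|l].
  apply: (gf_expR_ge hp (v := fun j => lam * w j)%R).
    by move=> k; rewrite mulr_ge0// ltW.
  rewrite EFinM -Mw /matvec ge0_sume_distrr//; last first.
    by move=> k _; rewrite mule_ge0 ?lee_fin.
  by apply: lee_sum => k _; rewrite EFinM muleCA.
have [i [r [ir pr rw]]] := non_deterministic_progeny w0.
(* The lower bound [exp (- w)] survives raising, and the upper bound 1 does because an entry is only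
   raised to below a value of [gf], itself at most 1. *)
pose dom : set (nat -> R) := [set s | forall j, (expR (- w j) <= s j <= 1)%R].
have dom01 s : dom s -> forall j, (0 < s j <= 1)%R.
  by move=> ds j; case/andP: (ds j) => ws ->; rewrite (lt_le_trans (expR_gt0 _) ws).
have dom01' s : dom s -> forall j, (0 <= s j <= 1)%R.
  by move=> /dom01 ds j; case/andP: (ds j) => /ltW -> ->.
pose Phi (s : nat -> R) j := (gf p s j)%:E.
pose s0 j : R := expR (- w j).
have ds0 : dom s0 by move=> j; rewrite lexx expR_le1 oppr_le0 w0'.
have ss0 : subinvariant Phi s0.
  by move=> j; rewrite lee_fin; apply: (gf_expR_ge hp w0'); rewrite Mw.
have sti : strict_at Phi s0 i.
  by rewrite /strict_at lte_fin; apply: (gf_expR_gt hp w0' _ ir pr rw); rewrite Mw.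
(* Strictness is available at the single type [i]; a path from [l] to [i] carries it to the given
   type [l]. *)
have [t [pt lt]] := hirr l i.
have [||| s [[ds ss] _ _ _ stl]] := @strict_propagate R Phi (fun a b => 0 < M a b) dom
  _ _ _ s0 i l t ds0 ss0 sti pt lt.
- move=> u u' du du' uu' j; rewrite lee_fin; apply: le_gf => //; exact: dom01'.
- move=> u k c du uc; rewrite lte_fin => cgf j; rewrite /set_at.
  case: eqP => [->|_]; last exact: du.
  have /andP[wu _] := du k; rewrite (le_trans wu (ltW uc))/=.
  rewrite (le_trans (ltW cgf))//.
  by case/andP: (gf_ge0_le1 hp k (dom01' u du)).
- move=> u u' k j du du' uu' uk Mjk; rewrite lee_fin lte_fin => /le_lt_trans; apply.
  by apply: lt_gf uk Mjk => //; exact: dom01.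
by exists s; split=> // j; rewrite -lee_fin; exact: ss.
Qed.

End converse.

Theorem lemma8 (R : realType) (p : nat -> (nat -> nat) -> R)
    (d : measure_display) (T : measurableType d) (P : probability T R)
    (xi : nat -> nat -> nat -> T -> nat -> nat) :
  offspring_law p ->
  offspring_family P p xi ->
  non_singular p ->
  (forall i : nat, 0 < mean_progeny p i i.+1) ->
  irreducible p ->
  (forall i : nat, partial_extinction P xi i = 1) <->
  (forall k : nat, 0 <= x_ (mean_progeny p) k < 1).
Proof.
move=> hp hxi hns Msup hirr; split=> [hext k|x01 i].
  exact: (x_of_extinction hp hxi Msup hirr hext).
exact: (extinction_of_x hp hxi hns Msup hirr).
Qed.
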